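(* Let $\theta_2\in J^2\pi$ and $p=\pi_2(\theta_2)$. For a horizontal subspace $H\subset\mathcal A_{\theta_2}$ satisfying $$\rho_{2,1}\bigl([\,j_p^3X,\,j_p^3Y\,]\bigr)=0\qquad\forall\,j_p^3X,j_p^3Y\in H,\qquad( * )$$ the 2-form $\omega_H\in g^2\otimes\wedge^2T_p^*$ is independent of the choice of $H$: if $H$ and $\tilde H$ are two horizontal subspaces of $\mathcal A_{\theta_2}$ satisfying $( * )$, then $\omega_H=\omega_{\tilde H}$.
   Context: All manifolds and maps are smooth. Let $\pi:\mathbb R^2\times\mathbb R^4\to\mathbb R^2$ be the product bundle with base coordinates $(x^1,x^2)=(x,y)$ and fibre coordinates $u^1,\dots,u^4$; its sections $p\mapsto(p,a^0(p),a^1(p),a^2(p),a^3(p))$ are identified with equations $y''=a^3y'^3+a^2y'^2+a^1y'+a^0$. A point transformation is a diffeomorphism $f$ of an open subset of $\mathbb R^2$ onto an open subset of $\mathbb R^2$. Its lift $f^{(0)}$ sends $(p,u)$ to $(f(p),\tilde u)$, where, with $g=(g^1,g^2)=f^{-1}$, subscripts denoting partial derivatives at $f(p)$, $A=g^1_1+g^1_2t$, $B=g^2_1+g^2_2t$, $Q^i=g^i_{11}+2g^i_{12}t+g^i_{22}t^2$, $J=g^1_1g^2_2-g^1_2g^2_1$, the $\tilde u^i$ are determined by the identity in $t$: $\sum_{i=0}^3\tilde u^{i+1}t^i=J^{-1}\bigl(\sum_{i=0}^3u^{i+1}B^iA^{3-i}-AQ^2+BQ^1\bigr)$ (this is the transformation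 of the coefficients of the equation under the change of variables $f$). $J^k\pi$ is the bundle of $k$-jets of sections of $\pi$, $\pi_k:J^k\pi\to\mathbb R^2$; $j_kS:p\mapsto j^k_pS$; $f^{(k)}(j^k_pS)=j^k_{f(p)}(f^{(0)}\circ S\circ f^{-1})$. A vector field $X$ on the base with flow $f_t$ lifts to the vector field $X^{(k)}$ on $J^k\pi$ with flow $f_t^{(k)}$. $W_p$ is the Lie algebra of $\infty$-jets at $p$ of vector fields on $\mathbb R^2$, $L^k_p\subset W_p$ the jets with zero $k$-jet; $W_p/L^k_p$ is the space of $k$-jets, $T_p=W_p/L^0_p$ is the tangent space, $\rho_{i,j}:W_p/L_p^i\to W_p/L_p^j$ the projection; the Lie bracket induces $[\cdot,\cdot]:W_p/L^k_p\times W_p/L^k_p\to W_p/L^{k-1}_p$. For $\theta_{k+1}=j^{k+1}_pS$, $\theta_k=j^k_pS$, let $\mathcal K_{\theta_{k+1}}$ be the tangent space at $\theta_k$ to the image of $j_kS$, and $\mathcal A_{\theta_{k+1}}=\{j^{k+2}_pX\in W_p/L_p^{k+2}: X^{(k)}_{\theta_k}\in\mathcal K_{\theta_{k+1}}\}$. A 2-dimensional subspace $H\subset\mathcal A_{\theta_{k+1}}$ is horizontal if $\rho_{k+2,0}|_H:H\to T_p$ is an isomorphism; then $\omega_H(X_p,Y_p)=[(\rho_{k+2,0}|_H)^{-1}(X_p),(\rho_{k+2,0}|_H)^{-1}(Y_p)]\in W_p/L_p^{k+1}$ for $X_p,Y_p\in T_p$. $g^2\subset L^1_p/L^2_p\cong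 T_p\otimes S^2T_p^*$ is the 2-dimensional subspace of 2-jets $(X^i_{jk})$ given by $X^2_{11}=0$, $X^1_{11}-2X^2_{12}=0$, $2X^1_{12}-X^2_{22}=0$, $X^1_{22}=0$. For $H\subset\mathcal A_{\theta_2}$ satisfying $( * )$, $\omega_H$ takes values in $g^2$. *)

(* Defs.v *)
From HB Require Import structures.
From mathcomp Require Import all_boot all_order all_algebra.
From mathcomp Require Import all_classical all_reals all_analysis.

Set Implicit Arguments.
Unset Strict Implicit.
Unset Printing Implicit Defensive.

Import Order.TTheory GRing.Theory Num.Theory.
Import numFieldNormedType.Exports.

Local Open Scope classical_set_scope.
Local Open Scope ring_scope.

(* C^oo on the open set [U]: every iterated directional derivative is Frechet
   differentiable (hence continuous) at every point of [U]. *)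
Definition smooth_on (R : realType) (V W : normedModType R) (U : set V)
    (f : V -> W) : Prop :=
  forall (s : seq V) (x : V), U x ->
    differentiable (foldr (fun v h => 'D_v h) f s) x.

(* [coord_dir 0] and [coord_dir 1] are the coordinate directions of x = x^1 and y = x^2; the
   index 0 (resp. 1) of ['I_2] is the index 1 (resp. 2) of the mathematics. *)
Definition coord_dir (R : realType) (i : 'I_2) : 'rV[R]_2 := delta_mx 0 i.

(* (d/dx)^a (d/dy)^b f *)
Definition pderiv (R : realType) (V : normedModType R) (a b : nat)
    (f : 'rV[R]_2 -> V) : 'rV[R]_2 -> V :=
  iter a (fun h => 'D_(coord_dir R 0) h) (iter b (fun h => 'D_(coord_dir R 1) h) f).

Notation mindex k :=
  {ab : 'I_k.+1 * 'I_k.+1 | ((ab.1 : nat) + (ab.2 : nat) <= k)%N}.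

Definition midx (k : nat) (al : mindex k) : 'I_k.+1 * 'I_k.+1 := val al.

Lemma midx_le (k : nat) (al : mindex k) : ((midx al).1 + (midx al).2 <= k)%N.
Proof. exact: valP al. Qed.

Definition widen_mindex (j k : nat) (le_jk : (j <= k)%N) (al : mindex j) :
    mindex k :=
  let w := widen_ord (le_jk : (j.+1 <= k.+1)%N) in
  exist _ (w (midx al).1, w (midx al).2) (leq_trans (midx_le al) le_jk).

(* A k-jet at a point is the family of the partial derivatives of order <= k
   (not divided by factorials). *)
Definition jet (k : nat) (V : Type) : Type := {ffun mindex k -> V}.

Definition jet_at (R : realType) (V : normedModType R) (k : nat)
    (p : 'rV[R]_2) (f : 'rV[R]_2 -> V) : jet k V :=
  [ffun al : mindex k => pderiv (midx al).1 (midx al).2 f p].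

Definition jproj (V : Type) (i j : nat) (le_ji : (j <= i)%N) (xi : jet i V) :
    jet j V :=
  [ffun al : mindex j => xi (widen_mindex le_ji al)].

(* The polynomial map whose k-jet at [p] is [xi]; it serves as representative
   of [xi] in operations that depend only on the jet of the representative. *)
Definition taylor (R : realType) (V : normedModType R) (k : nat)
    (p : 'rV[R]_2) (xi : jet k V) : 'rV[R]_2 -> V :=
  fun x => \sum_(al : mindex k)
    ((x 0 0 - p 0 0) ^+ (midx al).1 * (x 0 1 - p 0 1) ^+ (midx al).2
      / ((midx al).1`! * (midx al).2`!)%:R) *: xi al.

(* [vjet R k] is W_p/L^k_p, whatever [p]; in particular [vjet R 0] is T_p. *)
Notation vjet R k := ({ffun mindex k -> 'rV[R]_2}).

(* [X,Y]^i = X^j d_j Y^i - Y^j d_j X^i *)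
Definition lie (R : realType) (X Y : 'rV[R]_2 -> 'rV[R]_2) :
    'rV[R]_2 -> 'rV[R]_2 :=
  fun x => 'D_(X x) Y x - 'D_(Y x) X x.

(* The k-jet at [p] of [X,Y] depends only on the (k+1)-jets of X and Y, so any
   representatives may be used. *)
Definition jlie (R : realType) (k : nat) (p : 'rV[R]_2)
    (xi eta : vjet R k.+1) : vjet R k :=
  jet_at k p (lie (taylor p xi) (taylor p eta)).

Definition point_transformation (R : realType) (U V : set 'rV[R]_2)
    (f g : 'rV[R]_2 -> 'rV[R]_2) : Prop :=
  [/\ open U /\ open V,
      smooth_on U f /\ smooth_on V g,
      (forall x, U x -> V (f x)) /\ (forall y, V y -> U (g y)) &
      (forall x, U x -> g (f x) = x) /\ (forall y, V y -> f (g y) = y)].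

(* The lift f^(0), where [g] is the inverse of [f].  The variable t of the
   defining identity is ['X], and ~u^{i+1} is the coefficient of ['X^i]; the
   right-hand side has degree at most 3, so the identity holds in full. *)
Definition point_lift (R : realType) (f g : 'rV[R]_2 -> 'rV[R]_2)
    (z : 'rV[R]_2 * 'rV[R]_4) : 'rV[R]_2 * 'rV[R]_4 :=
  let q := f z.1 in
  let u := z.2 in
  let g1 (i : 'I_2) := pderiv 1 0 g q 0 i in
  let g2 (i : 'I_2) := pderiv 0 1 g q 0 i in
  let g11 (i : 'I_2) := pderiv 2 0 g q 0 i in
  let g12 (i : 'I_2) := pderiv 1 1 g q 0 i in
  let g22 (i : 'I_2) := pderiv 0 2 g q 0 i in
  let A : {poly R} := (g1 0)%:P + g2 0 *: 'X in
  let B : {poly R} := (g1 1)%:P + g2 1 *: 'X in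
  let Q (i : 'I_2) : {poly R} :=
    (g11 i)%:P + (2 * g12 i) *: 'X + g22 i *: 'X^2 in
  let J : R := g1 0 * g2 1 - g2 0 * g1 1 in
  let P : {poly R} :=
    J^-1 *: (\sum_(i < 4) u 0 i *: (B ^+ i * A ^+ (3 - i)) - A * Q 1 + B * Q 0)
  in (q, \row_(i < 4) P`_i).

(* Global coordinates (p, u_p^k) on J^k pi; the section p |-> (p, S p) is
   identified with its fibre component [S]. *)
Notation Jpi R k := (('rV[R]_2 * {ffun mindex k -> 'rV[R]_4})%type).

(* Tangent vectors of J^k pi in the same global coordinates *)
Notation TJpi R k := (('rV[R]_2 * {ffun mindex k -> 'rV[R]_4})%type).

Definition jS (R : realType) (k : nat) (S : 'rV[R]_2 -> 'rV[R]_4)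
    (p : 'rV[R]_2) : Jpi R k :=
  (p, jet_at k p S).

Definition Jproj (R : realType) (i j : nat) (le_ji : (j <= i)%N)
    (theta : Jpi R i) : Jpi R j :=
  (theta.1, jproj le_ji theta.2).

Definition section_of (R : realType) (k : nat) (theta : Jpi R k) :
    'rV[R]_2 -> 'rV[R]_4 :=
  taylor theta.1 theta.2.

(* f^(k) (j^k_p S) = j^k_{f p} (f^(0) o S o f^-1), with [g] the inverse of [f] *)
Definition liftk (R : realType) (k : nat) (f g : 'rV[R]_2 -> 'rV[R]_2)
    (theta : Jpi R k) : Jpi R k :=
  let S := section_of theta in
  jS k (fun q => (point_lift f g (g q, S (g q))).2) (f theta.1).

Definition velocity (R : realType) (k : nat) (c : R -> Jpi R k) (t : R)
    (v : TJpi R k) : Prop :=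
  is_derive t (1 : R) (fun s => (c s).1) v.1 /\
  forall al : mindex k, is_derive t (1 : R) (fun s => (c s).2 al) (v.2 al).

(* [F] is the flow of [X], with flow domain [D]; its time-t map is a
   diffeomorphism of D_t onto D_{-t}, with inverse the time-(-t) map. *)
Definition is_flow (R : realType) (X : 'rV[R]_2 -> 'rV[R]_2)
    (D : set (R * 'rV[R]_2)) (F : R -> 'rV[R]_2 -> 'rV[R]_2) : Prop :=
  [/\ open D /\ (forall x, D (0, x) /\ is_interval [set t | D (t, x)]),
      smooth_on D (fun tx : R * 'rV[R]_2 => F tx.1 tx.2),
      forall x, F 0 x = x,
      forall t x, D (t, x) ->
        is_derive t (1 : R) (fun s => F s x) (X (F t x)) &
      forall t, point_transformation [set x | D (t, x)] [set x | D (- t, x)]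
        (F t) (F (- t))].

(* X^(k) takes the value [v] at [theta] *)
Definition prolongation (R : realType) (k : nat) (X : 'rV[R]_2 -> 'rV[R]_2)
    (theta : Jpi R k) (v : TJpi R k) : Prop :=
  exists D F, is_flow X D F /\
    velocity (fun t => liftk (F t) (F (- t)) theta) 0 v.

(* The tangent space at theta_k to the image of j_k S, i.e. the image of the
   differential of j_k S at p. *)
Definition Kspace (R : realType) (k : nat) (theta : Jpi R k.+1) :
    set (TJpi R k) :=
  [set v | exists w : 'rV[R]_2, let S := section_of theta in
    v = (w, [ffun al : mindex k =>
               'D_w (pderiv (midx al).1 (midx al).2 S) theta.1])].

Definition Aspace (R : realType) (k : nat) (theta : Jpi R k.+1) :
    set (vjet R k.+2) :=
  [set xi | exists X, [/\ smooth_on setT X,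
      jet_at k.+2 theta.1 X = xi &
      exists2 v, prolongation X (Jproj (leqnSn k) theta) v & Kspace theta v]].

Definition horizontal (R : realType) (k : nat) (theta : Jpi R k.+1)
    (H : {vspace vjet R k.+2}) : Prop :=
  [/\ forall xi, xi \in H -> Aspace theta xi,
      \dim H = 2%N &
      forall v : vjet R 0,
        exists! xi, xi \in H /\ jproj (leq0n k.+2) xi = v].

Definition hlift (R : realType) (k : nat) (H : {vspace vjet R k.+2})
    (v : vjet R 0) : vjet R k.+2 :=
  xget 0 [set xi | xi \in H /\ jproj (leq0n k.+2) xi = v].

Definition omega (R : realType) (k : nat) (p : 'rV[R]_2)
    (H : {vspace vjet R k.+2}) (v w : vjet R 0) : vjet R k.+1 :=
  jlie p (hlift H v) (hlift H w).

Definition bracket_1jet_zero (R : realType) (p : 'rV[R]_2) (H : {vspace vjet R 3}) : Prop :=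
  forall xi eta, xi \in H -> eta \in H ->
    jproj (leqnSn 1) (jlie p xi eta) = 0.

Definition mi2 (a b : nat) (le_ab : (a + b <= 2)%N) : mindex 2 :=
  exist _ (Ordinal (leq_trans (leq_addr b a) le_ab : (a < 3)%N),
           Ordinal (leq_trans (leq_addl a b) le_ab : (b < 3)%N)) le_ab.

Definition g2space (R : realType) : set (vjet R 2) :=
  [set xi : vjet R 2 | jproj (leqnSn 1) xi = 0 /\
    let X11 (i : 'I_2) := xi (@mi2 2 0 isT) 0 i in
    let X12 (i : 'I_2) := xi (@mi2 1 1 isT) 0 i in
    let X22 (i : 'I_2) := xi (@mi2 0 2 isT) 0 i in
    [/\ X11 1 = 0, X11 0 - 2 * X12 1 = 0, 2 * X12 0 - X22 1 = 0 & X22 0 = 0]].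

(* elements of G tensor Lambda^2 T_p^*: alternating bilinear maps with values in G *)
Definition two_form (R : realType) (k : nat) (G : set (vjet R k))
    (om : vjet R 0 -> vjet R 0 -> vjet R k) : Prop :=
  [/\ forall w, linear (om^~ w),
      forall v, linear (om v),
      forall v, om v v = 0 &
      forall v w, G (om v w)].

(* Main.v *)
(* A 3-jet of a vector field X lies in A_theta iff the Lie derivative E(X) of a section
   representing theta vanishes at p together with its first derivatives; only the
   direct implication is needed. It comes from differentiating at t = 0 the lift of the
   flow F_t along the curve t |-> F_t p: there F_{-t}(F_t p) = p is constant, and
   symmetry of mixed partials shows that the derivatives D_w F_{-t} (F_t p), |w| > 0,
   have rate - D_w X p.
   Let X and Y be the lifts to H of the two coordinate vectors. The twelve equations on
   X, the twelve on Y and the vanishing of the 1-jet of [X, Y] determine the 2-jet of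
   [X, Y]: modulo these relations its coefficients are 0, L_i or 2 L_i, where L_1 and
   L_2 are the Liouville invariants, polynomials in theta alone. *)
Require Import Defs.
From mathcomp Require Import all_boot all_order all_algebra.
From mathcomp Require Import all_classical all_reals all_analysis.
From mathcomp Require Import ring lra.

Set Implicit Arguments.
Unset Strict Implicit.
Unset Printing Implicit Defensive.

Import Order.TTheory GRing.Theory Num.Theory.
Import numFieldNormedType.Exports.

Local Open Scope classical_set_scope.
Local Open Scope ring_scope.

(** * Symmetry of mixed partial derivatives *)

(** The elimination succeeds for a reason of symbols. Up to order and lower terms, the eight
    differentiated equations on X read X^2_111, X^2_112, 2 X^2_112 - X^1_111, 2 X^2_122 - X^1_112,
    X^2_122 - 2 X^1_112, X^2_222 - 2 X^1_122, -X^1_122, -X^1_222. This system is invertible, so the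
    third order of X is fixed by theta and the lower order of X; likewise for Y. The eight
    undifferentiated equations on X and Y and the four first derivatives of [X, Y] form another
    invertible system, for the twelve second derivatives of X and Y. Both systems contain a block of
    determinant 3 up to sign, whence the thirds in the formulas. Only first derivatives stay free,
    and the six identities for the second derivatives of [X, Y] show that these cancel. *)

Lemma smooth_on_diff (R : realType) (V W : normedModType R) (U : set V)
    (f : V -> W) (x : V) : smooth_on U f -> U x -> differentiable f x.
Proof. by move=> sf Ux; exact: (sf [::] x Ux). Qed.

Lemma smooth_on_derive (R : realType) (V W : normedModType R) (U : set V)
    (f : V -> W) (v : V) : smooth_on U f -> smooth_on U ('D_v f).
Proof. by move=> sf s x Ux; have := sf (rcons s v) x Ux; rewrite foldr_rcons. Qed.

Lemma smooth_on_foldr (R : realType) (V W : normedModType R) (U : set V)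
    (f : V -> W) (s : seq V) :
  smooth_on U f -> smooth_on U (foldr (fun v h => 'D_v h) f s).
Proof.
by move=> sf; elim: s => [//|v s IHs]; exact: smooth_on_derive.
Qed.

Lemma is_derive_line (R : realType) (V W : normedModType R) (f : V -> W)
    (x u : V) (s : R) :
  differentiable f (x + s *: u) ->
  is_derive s (1 : R) (fun r => f (x + r *: u)) ('D_u f (x + s *: u)).
Proof.
move=> df; have dfu : derivable f (x + s *: u) u by exact: diff_derivable.
have E : (fun h : R => h^-1 *: (((fun r => f (x + r *: u)) \o shift s) (h *: (1 : R))
    - f (x + s *: u))) =
  (fun h : R => h^-1 *: ((f \o shift (x + s *: u)) (h *: u) - f (x + s *: u))).
  apply/funext => h /=; congr (_ *: (f _ - _)).
  by rewrite [h *: 1]mulr1 scalerDl addrCA.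
apply: DeriveDef; first by rewrite /derivable E.
by rewrite /derive E.
Qed.

Lemma mvt_dir (R : realType) (V : normedModType R) (f : V -> R) (x u : V)
    (h : R) :
  0 < h -> (forall s, 0 <= s <= h -> differentiable f (x + s *: u)) ->
  exists2 s, 0 <= s <= h & f (x + h *: u) - f x = h * 'D_u f (x + s *: u).
Proof.
move=> h0 df.
have [|||s] := @MVT_segment R (fun r => f (x + r *: u))
    (fun r => 'D_u f (x + r *: u)) 0 h.
- exact: ltW.
- move=> s; rewrite in_itv /= => /andP[s0 sh].
  by apply: is_derive_line; apply: df; rewrite !ltW.
- apply: derivable_within_continuous => s; rewrite in_itv /= => sh.
  by have [] := is_derive_line (df s sh).
- by rewrite in_itv /= scale0r addr0 subr0 mulrC => sh E; exists s.
Qed.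

(** The mean value theorem twice: along u for y |-> f (y + h v) - f y, then along v for [fu]. *)
Lemma second_difference (R : realType) (V : normedModType R) (U : set V)
    (f fu fvu : V -> R) (x u v : V) (h : R) :
  0 < h ->
  (forall y, U y -> differentiable f y /\ 'D_u f y = fu y) ->
  (forall y, U y -> differentiable fu y /\ 'D_v fu y = fvu y) ->
  (forall s r, 0 <= s <= h -> 0 <= r <= h -> U (x + s *: u + r *: v)) ->
  exists s r, [/\ 0 <= s <= h, 0 <= r <= h &
    f (x + h *: u + h *: v) - f (x + h *: u) - (f (x + h *: v) - f x)
      = h * (h * fvu (x + s *: u + r *: v))].
Proof.
move=> h0 Hf Hfu HU; have hh : 0 <= h <= h by rewrite lexx ltW.
have h00 : 0 <= (0 : R) <= h by rewrite lexx ltW.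
pose F y := f (y + h *: v) - f y.
have dF s : 0 <= s <= h -> is_derive s (1 : R) (fun r => F (x + r *: u))
   (fu (x + s *: u + h *: v) - fu (x + s *: u)).
  move=> sh; have Ush := HU s h sh hh.
  have Us0 : U (x + s *: u) by have := HU s 0 sh h00; rewrite scale0r addr0.
  apply: is_deriveB.
    have E : (fun r => f (x + r *: u + h *: v)) =
       (fun r => f (x + h *: v + r *: u)) by apply/funext => r; rewrite addrAC.
    rewrite E -(Hf _ Ush).2 addrAC; apply: is_derive_line; rewrite addrAC.
    exact: (Hf _ Ush).1.
  by rewrite -(Hf _ Us0).2; apply: is_derive_line; exact: (Hf _ Us0).1.
have [|||s sh E] := @MVT_segment R (fun r => F (x + r *: u))
    (fun s => fu (x + s *: u + h *: v) - fu (x + s *: u)) 0 h.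
- exact: ltW.
- by move=> s; rewrite in_itv /= => /andP[s0 sh]; apply: dF; rewrite !ltW.
- apply: derivable_within_continuous => s; rewrite in_itv /= => sh.
  by have [] := dF s sh.
move: sh; rewrite in_itv /= => sh.
have [r rh Er] := @mvt_dir R V fu (x + s *: u) v h h0
  (fun r rh => (Hfu _ (HU s r sh rh)).1).
exists s, r; split=> //; rewrite -(Hfu _ (HU s r sh rh)).2 -Er.
by move: E; rewrite /F scale0r addr0 subr0 => ->; rewrite mulrC.
Qed.

(** A second difference is unchanged when u and v are exchanged, so some value of [fvu] close to x
    equals some value of [fuv] close to x. Continuity at x then excludes a gap between the two
    limits. *)
Lemma mixed_partials_eq (R : realType) (V : normedModType R) (U : set V)
    (f fu fv fuv fvu : V -> R) (x u v : V) :
  open U -> U x ->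
  (forall y, U y -> [/\ differentiable f y, 'D_u f y = fu y & 'D_v f y = fv y]) ->
  (forall y, U y -> differentiable fu y /\ 'D_v fu y = fvu y) ->
  (forall y, U y -> differentiable fv y /\ 'D_u fv y = fuv y) ->
  {for x, continuous fuv} -> {for x, continuous fvu} ->
  fuv x = fvu x.
Proof.
move=> oU Ux Hf Hfu Hfv /cvgrPdist_lt cuv /cvgrPdist_lt cvu.
have Uc : nbhs x U by exact: open_nbhs_nbhs.
apply/eqP/negPn/negP => neq.
pose e := `|fuv x - fvu x| / 2.
have e0 : 0 < e by rewrite divr_gt0// normr_gt0 subr_eq0.
have : nbhs x (U `&`
    ([set t | `|fuv x - fuv t| < e] `&` [set t | `|fvu x - fvu t| < e])).
  by apply: filterI => //; apply: filterI; [exact: cuv|exact: cvu].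
move=> /nbhs_ballP[d /= d0 Hd].
(* The parallelogram with sides h u and h v fits in the ball of radius d; the summand 1 keeps the
   denominator positive when u = v = 0. *)
pose h := d / (`|u| + `|v| + 1).
have n0 : 0 < `|u| + `|v| + 1 by rewrite ltr_wpDl// addr_ge0// normr_ge0.
have h0 : 0 < h by rewrite divr_gt0.
have Hb s r (a b : V) : `|a| + `|b| = `|u| + `|v| -> 0 <= s <= h -> 0 <= r <= h ->
    ball x d (x + s *: a + r *: b).
  move=> ab /andP[s0 sh] /andP[r0 rh].
  rewrite -ball_normE /ball_ /= -addrA opprD addNKr normrN.
  apply: le_lt_trans (ler_normD _ _) _; rewrite !normrZ (ger0_norm s0) (ger0_norm r0).
  apply: (@le_lt_trans _ _ (h * (`|a| + `|b|))).
    by rewrite mulrDr lerD// ler_wpM2r.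
  by rewrite ab /h mulrAC ltr_pdivrMr// ltr_pM2l// ltrDl.
have [|s [r [sh rh E]]] := second_difference h0 _ Hfu
  (fun s r sh rh => (Hd _ (Hb s r u v erefl sh rh)).1) (f := f).
  by move=> y /Hf[].
have [|s' [r' [sh' rh' E']]] := second_difference h0 _ Hfv
  (fun s r sh rh => (Hd _ (Hb s r v u (addrC _ _) sh rh)).1) (f := f).
  by move=> y /Hf[].
have hI (a b : R) : h * (h * a) = h * (h * b) -> a = b.
  by move=> /(mulfI (lt0r_neq0 h0)) /(mulfI (lt0r_neq0 h0)).
have exch (a b c k : R) : a - b - (c - k) = a - c - (b - k) by ring.
have {E E'} E : fvu (x + s *: u + r *: v) = fuv (x + s' *: v + r' *: u).
  by apply: hI; rewrite -E -E' exch [in LHS](addrAC x).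
have [_ [/= _ H1]] := Hd _ (Hb s r u v erefl sh rh).
have [_ [/= H2 _]] := Hd _ (Hb s' r' v u (addrC _ _) sh' rh').
rewrite E in H1; move: H1 H2; rewrite /e.
have half (a b c : R) : `|b - c| < `|a - b| / 2 -> `|a - c| < `|a - b| / 2 -> False.
  move=> bc ac; have := ler_distD c a b; rewrite (distrC c b) leNgt => /negP; apply.
  by rewrite [ltRHS]splitr ltrD.
exact: half.
Qed.

Lemma derive_coord (R : realType) (V : normedModType R) (m n : nat)
    (f : V -> 'M[R]_(m, n)) (x v : V) (i : 'I_m) (j : 'I_n) :
  derivable f x v -> 'D_v (fun y => f y i j) x = 'D_v f x i j.
Proof. by move=> df; rewrite derive_mx// mxE. Qed.

Lemma is_derive_mxP (R : realType) (V : normedModType R) (m n : nat)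
    (f : V -> 'M[R]_(m, n)) (x v : V) (df : 'M[R]_(m, n)) :
  is_derive x v f df <->
  forall i j, is_derive x v (fun y => f y i j) (df i j).
Proof.
split=> [[dfx <-] i j|H].
  by apply: DeriveDef; [exact: ((derivable_mxP f x v).1 dfx i j)|rewrite derive_coord].
have dfx : derivable f x v.
  by apply/derivable_mxP => i j; have [] := H i j.
apply: DeriveDef => //; apply/matrixP => i j.
by rewrite -derive_coord//; have [] := H i j.
Qed.

Lemma differentiable_entry (R : realType) (V : normedModType R) (m n : nat)
    (f : V -> 'M[R]_(m, n)) (x : V) (i : 'I_m) (j : 'I_n) :
  differentiable f x -> differentiable (fun y => f y i j) x.
Proof.
move=> df; apply: (@differentiable_comp _ _ _ _ f (fun M : 'M[R]_(m, n) => M i j)) => //.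
exact: differentiable_coord.
Qed.

Lemma schwarz (R : realType) (V : normedModType R) (n : nat) (U : set V)
    (f : V -> 'rV[R]_n) (x u v : V) :
  open U -> smooth_on U f -> U x -> 'D_u ('D_v f) x = 'D_v ('D_u f) x.
Proof.
move=> oU sf Ux; apply/rowP => i.
have sd (w : V) := smooth_on_derive w sf.
have sdd (w w' : V) := smooth_on_derive w' (sd w).
apply: (@mixed_partials_eq R V U (fun y => f y 0 i) (fun y => 'D_u f y 0 i)
  (fun y => 'D_v f y 0 i) (fun y => 'D_u ('D_v f) y 0 i)
  (fun y => 'D_v ('D_u f) y 0 i) x u v oU Ux).
- move=> y Uy; have df := smooth_on_diff sf Uy.
  by split; [exact: differentiable_entry| |]; rewrite derive_coord//; exact: diff_derivable.
- move=> y Uy; have df := smooth_on_diff (sd u) Uy.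
  by split; [exact: differentiable_entry|rewrite derive_coord//; exact: diff_derivable].
- move=> y Uy; have df := smooth_on_diff (sd v) Uy.
  by split; [exact: differentiable_entry|rewrite derive_coord//; exact: diff_derivable].
- apply: differentiable_continuous.
  exact: differentiable_entry (smooth_on_diff (sdd v u) Ux).
- apply: differentiable_continuous.
  exact: differentiable_entry (smooth_on_diff (sdd u v) Ux).
Qed.

(** * Jets of a flow *)

Notation Dw w f := (foldr (fun v h => 'D_v h) f w).

Lemma derive_linear_dir (R : realType) (V W : normedModType R) (f : V -> W)
    (x u v : V) (a : R) :
  differentiable f x -> 'D_(a *: u + v) f x = a *: 'D_u f x + 'D_v f x.
Proof. by move=> df; rewrite !deriveE// linearP. Qed.

Lemma Dw_commute (R : realType) (V : normedModType R) (n : nat) (U : set V)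
    (f : V -> 'rV[R]_n) (e x : V) (w : seq V) :
  open U -> smooth_on U f -> U x -> 'D_e (Dw w f) x = Dw w ('D_e f) x.
Proof.
move=> oU sf; elim: w x => [//|v w IHw] x Ux /=.
rewrite (schwarz _ _ oU (smooth_on_foldr w sf) Ux).
apply: near_eq_derive; have : nbhs x U by exact: open_nbhs_nbhs (conj oU Ux).
by apply: filterS => y /IHw.
Qed.

Lemma derive_slice (R : realType) (V W : normedModType R) (g : R -> V -> W)
    (v : V) (tx : R * V) :
  'D_((0, v) : R * V) (fun z : R * V => g z.1 z.2) tx = 'D_v (g tx.1) tx.2.
Proof.
have E : (fun h : R => h^-1 *: (((fun z : R * V => g z.1 z.2) \o shift tx)
      (h *: ((0, v) : R * V)) - g tx.1 tx.2)) =
    (fun h => h^-1 *: ((g tx.1 \o shift tx.2) (h *: v) - g tx.1 tx.2)).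
  by apply/funext => h /=; rewrite scaler0 add0r.
by rewrite /derive E.
Qed.

Lemma Dw_slice (R : realType) (V W : normedModType R) (g : R -> V -> W)
    (w : seq V) :
  Dw [seq ((0, v) : R * V) | v <- w] (fun z : R * V => g z.1 z.2) =
  fun z => Dw w (g z.1) z.2.
Proof.
elim: w => [//|v w /= ->]; apply/funext => z.
exact: (@derive_slice R V W (fun t => Dw w (g t))).
Qed.

Lemma Dw_cst (R : realType) (V W : normedModType R) (c : W) (w : seq V) (v x : V) :
  Dw (v :: w) (cst c) x = 0.
Proof.
elim: w v x => [|u w IHw] v x /=; first exact: (@derive_cst R V W c x v).
have -> : 'D_u (Dw w (cst c)) = cst 0 by apply/funext => y; exact: IHw.
exact: (@derive_cst R V W 0 x v).
Qed.

Lemma Dw_id (R : realType) (V : normedModType R) (w : seq V) (u v x : V) :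
  Dw [:: u, v & w] id x = 0.
Proof.
(* The last letter of a word acts first: it turns the identity into a constant, which the nonempty
   rest of the word kills. *)
rewrite (lastI v w) -cats1 -cat_cons foldr_cat /=.
have -> : 'D_(last v w) id = cst (last v w).
  by apply/funext => y; exact: derive_id.
exact: Dw_cst.
Qed.

(** Chain rule for (t, x) |-> D_w F_t x along the curve (-t, F_t p), whose velocity at 0 is (-1, X
    p). The spatial part differentiates F_0 = id at least twice, because w is nonempty, and
    vanishes. In the time part d/dt passes through D_w and turns F into X. *)
Lemma is_derive_flow_jet (R : realType) (X : 'rV[R]_2 -> 'rV[R]_2)
    (D : set (R * 'rV[R]_2)) (F : R -> 'rV[R]_2 -> 'rV[R]_2)
    (p : 'rV[R]_2) (w : seq 'rV[R]_2) :
  is_flow X D F -> w != [::] ->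
  is_derive (0 : R) (1 : R) (fun t => Dw w (F (- t)) (F t p)) (- Dw w X p).
Proof.
case: w => [//|v w] + _; case=> -[oD HD] sF F0 dF _.
pose Fj (z : R * 'rV[R]_2) := F z.1 z.2.
pose w0 := [seq ((0, u) : R * 'rV[R]_2) | u <- v :: w].
pose K := Dw w0 Fj.
have KE : K = fun z => Dw (v :: w) (F z.1) z.2 by exact: Dw_slice.
have sK : smooth_on D K by exact: smooth_on_foldr.
have D0 x : D (0, x) by have [] := HD x.
pose gam (t : R) : R * 'rV[R]_2 := (- t, F t p).
have gam0 : gam 0 = (0, p) by rewrite /gam oppr0 F0.
have dFp : is_derive (0 : R) (1 : R) (fun t => F t p) (X p).
  by have := dF 0 p (D0 p); rewrite F0.
have dFp' : differentiable (fun t => F t p) 0.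
  by apply/derivable1_diffP; case: dFp.
have dN : is_derive (0 : R) (1 : R) (fun t : R => - t) (-1).
  exact: (@is_deriveNid R R 0 1).
have dN' : differentiable (fun t : R => - t) 0.
  by apply/derivable1_diffP; case: dN.
have dgam : differentiable gam 0 by exact: differentiable_pair.
have dK : differentiable K (gam 0).
  by rewrite gam0; exact: smooth_on_diff sK (D0 p).
have dKg : differentiable (K \o gam) 0 by exact: differentiable_comp.
have -> : (fun t => Dw (v :: w) (F (- t)) (F t p)) = K \o gam by rewrite KE.
apply: DeriveDef; first exact: diff_derivable.
rewrite deriveE// diff_comp//= /gam diff_pair//= -!deriveE//.
have [_ ->] := dN; have [_ ->] := dFp.
rewrite -/(gam 0).
have -> : ((-1, X p) : R * 'rV[R]_2) = (-1) *: (1, 0) + (0, X p).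
  by apply/pair_equal_spec; split => /=; rewrite ?scaler0 ?addr0 ?add0r ?[_ *: 1]mulr1.
rewrite derive_linear_dir// gam0.
have -> : 'D_((0, X p) : R * 'rV[R]_2) K (0, p) = 0.
  rewrite KE (@derive_slice _ _ _ (fun t => Dw (v :: w) (F t))) /=.
  have -> : F 0 = id by apply/funext => x; rewrite F0.
  exact: Dw_id.
rewrite addr0 scaleN1r /K (Dw_commute _ _ oD sF (D0 p)); congr (- _).
pose g t x := 'D_((1, 0) : R * 'rV[R]_2) Fj (t, x).
have -> : 'D_((1, 0) : R * 'rV[R]_2) Fj = fun z => g z.1 z.2.
  by apply/funext => -[].
rewrite Dw_slice /=.
have -> : g 0 = X; last by [].
apply/funext => x; have := dF 0 x (D0 x); rewrite F0 => -[_ <-].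
have E : (fun h : R => h^-1 *: ((Fj \o shift (0, x))
      (h *: ((1, 0) : R * 'rV[R]_2)) - Fj (0, x))) =
    (fun h => h^-1 *: (((fun s => F s x) \o shift 0) (h *: (1 : R)) - F 0 x)).
  by apply/funext => h /=; rewrite /Fj /= scaler0 add0r.
by rewrite /g /derive E.
Qed.

(** * The lift of a change of variables as a rational expression *)

(** Reified polynomials make iterated differentiation a computation on syntax. The single rule
    [is_derive_peval] then serves base derivatives of the lift, rates along the flow and jets of
    brackets. *)
Inductive pexp (T C : Type) : Type :=
  | PC of C
  | PV of T
  | PA of pexp T C & pexp T C
  | PM of pexp T C & pexp T C.
Arguments PC {T C}.
Arguments PV {T C}.

Declare Scope pexp_scope.
Delimit Scope pexp_scope with P.
Bind Scope pexp_scope with pexp.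
Infix "+" := PA : pexp_scope.
Infix "*" := PM : pexp_scope.

Fixpoint peval (T : Type) (R : pzRingType) (env : T -> R) (e : pexp T R) : R :=
  match e with
  | PC c => c
  | PV n => env n
  | PA a b => peval env a + peval env b
  | PM a b => peval env a * peval env b
  end.

(* Leibniz rule, [s] giving the derivatives of the variables. *)
Fixpoint pdiff (T : Type) (R : pzRingType) (s : T -> pexp T R) (e : pexp T R) :
    pexp T R :=
  match e with
  | PC _ => PC 0
  | PV n => s n
  | PA a b => PA (pdiff s a) (pdiff s b)
  | PM a b => PA (PM a (pdiff s b)) (PM (pdiff s a) b)
  end.

Lemma is_derive_peval (R : realType) (V : normedModType R) (T : Type)
    (env : V -> T -> R) (s : T -> pexp T R) (x v : V) (e : pexp T R) :
  (forall n, is_derive x v (fun y => env y n) (peval (env x) (s n))) ->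
  is_derive x v (fun y => peval (env y) e) (peval (env x) (pdiff s e)).
Proof.
move=> Hs; elim: e => [c|n|a IHa b IHb|a IHa b IHb] /=.
- exact: (@is_derive_cst R V R c x v).
- exact: Hs.
- exact: is_deriveD.
- have H := @is_deriveM R V _ _ x v _ _ IHa IHb.
  by apply: (is_derive_eq H); rewrite [X in _ + X]mulrC.
Qed.

(* Directions and components of the plane are coded by booleans:
   [false] is the index 1 and [true] the index 2 of the mathematics. *)
Definition ob (b : bool) : 'I_2 := if b then 1 else 0.

Definition cdir (R : realType) (b : bool) : 'rV[R]_2 := coord_dir R (ob b).

Lemma row2E (R : realType) (v : 'rV[R]_2) :
  v = v 0 0 *: cdir R false + v 0 1 *: cdir R true.
Proof.
apply/rowP => i; rewrite !mxE /= /ob.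
have [->|->] : i = 0 \/ i = 1.
  by case: i => -[|[|//]] Hi; [left|right]; apply: val_inj.
- by rewrite /= mulr1 mulr0 addr0.
- by rewrite /= mulr1 mulr0 add0r.
Qed.

Lemma derive_coords (R : realType) (W : normedModType R) (f : 'rV[R]_2 -> W)
    (x w : 'rV[R]_2) :
  differentiable f x ->
  'D_w f x = w 0 0 *: 'D_(cdir R false) f x + w 0 1 *: 'D_(cdir R true) f x.
Proof. by move=> df; rewrite !deriveE// {1}(row2E w) linearD !linearZ. Qed.

Lemma entry_comb (R : pzRingType) (m n : nat) (a b : R) (A B : 'M[R]_(m, n))
    (i : 'I_m) (j : 'I_n) :
  (a *: A + b *: B) i j = a * A i j + b * B i j.
Proof. by rewrite !mxE. Qed.

Definition wd (R : realType) (w : seq bool) : seq 'rV[R]_2 := map (@cdir R) w.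

(* [VG i j w] is the derivative of the i-th component of the inverse change of
   variables along the nonempty word [rcons w j], [VU m] is the (m+1)-st
   coefficient of the equation and [VK] is 1/J. *)
Inductive lvar : Type := VG of bool & bool & seq bool | VU of nat | VK.

Definition Jexp (R : realType) : pexp lvar R :=
  let g i j := PV (VG i j [::]) in
  (g false false * g true true + PC (-1) * (g false true * g true false))%P.

(** Coefficient of t^m in the defining identity of the lift before division by J, with A = a0 + a1
    t, B = b0 + b1 t and Q^i = q i + 2 (r i) t + (s i) t^2. *)
Definition coef_exp (R : realType) (m : nat) : pexp lvar R :=
  let a0 := PV (VG false false [::]) in
  let a1 := PV (VG false true [::]) in
  let b0 := PV (VG true false [::]) in
  let b1 := PV (VG true true [::]) in
  let u0 := PV (VU 0) in let u1 := PV (VU 1) in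
  let u2 := PV (VU 2) in let u3 := PV (VU 3) in
  let q i := PV (VG i false [:: false]) in
  let r i := PV (VG i true [:: false]) in
  let s i := PV (VG i true [:: true]) in
  let n2 := PC 2 in let n3 := PC 3 in
  (match m with
  | 0 => u0 * (a0 * a0 * a0) + u1 * (b0 * a0 * a0) + u2 * (b0 * b0 * a0)
         + u3 * (b0 * b0 * b0)
         + (PC (-1) * (a0 * q true) + b0 * q false)
  | 1 => u0 * (n3 * (a0 * a0 * a1)) + u1 * (b1 * a0 * a0 + n2 * (b0 * a0 * a1))
         + u2 * (b0 * b0 * a1 + n2 * (b0 * b1 * a0)) + u3 * (n3 * (b0 * b0 * b1))
         + (PC (-1) * (n2 * (a0 * r true) + a1 * q true)
            + (n2 * (b0 * r false) + b1 * q false))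
  | 2 => u0 * (n3 * (a0 * a1 * a1)) + u1 * (b0 * a1 * a1 + n2 * (b1 * a0 * a1))
         + u2 * (b1 * b1 * a0 + n2 * (b0 * b1 * a1)) + u3 * (n3 * (b0 * b1 * b1))
         + (PC (-1) * (a0 * s true + n2 * (a1 * r true))
            + (b0 * s false + n2 * (b1 * r false)))
  | _ => u0 * (a1 * a1 * a1) + u1 * (b1 * a1 * a1) + u2 * (b1 * b1 * a1)
         + u3 * (b1 * b1 * b1)
         + (PC (-1) * (a1 * s true) + b1 * s false)
  end)%P.

Definition lift_exp (R : realType) (m : nat) : pexp lvar R :=
  (PV VK * coef_exp R m)%P.

Definition lift_env (R : realType) (g : 'rV[R]_2 -> 'rV[R]_2)
    (S : 'rV[R]_2 -> 'rV[R]_4) (q : 'rV[R]_2) (n : lvar) : R :=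
  let jt i j w := Dw (wd R w) ('D_(cdir R j) g) q 0 (ob i) in
  match n with
  | VG i j w => jt i j w
  | VU m => S (g q) 0 (inord m)
  | VK => (jt false false [::] * jt true true [::]
           - jt false true [::] * jt true false [::])^-1
  end.

Lemma lift_poly_coef (R : comNzRingType)
    (u0 u1 u2 u3 a0 a1 b0 b1 q0 q1 r0 r1 s0 s1 : R) (m : 'I_4) :
  let A : {poly R} := a0%:P + a1 *: 'X in
  let B : {poly R} := b0%:P + b1 *: 'X in
  (u0 *: (B ^+ 0 * A ^+ 3) + (u1 *: (B ^+ 1 * A ^+ 2)
   + (u2 *: (B ^+ 2 * A ^+ 1) + (u3 *: (B ^+ 3 * A ^+ 0) + 0)))
   - A * (q1%:P + (2 * r1) *: 'X + s1 *: 'X^2)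
   + B * (q0%:P + (2 * r0) *: 'X + s0 *: 'X^2))`_m =
  match m : nat with
  | 0%N => u0 * (a0 * a0 * a0) + u1 * (b0 * a0 * a0) + u2 * (b0 * b0 * a0)
    + u3 * (b0 * b0 * b0) + (-1 * (a0 * q1) + b0 * q0)
  | 1%N => u0 * (3 * (a0 * a0 * a1)) + u1 * (b1 * a0 * a0 + 2 * (b0 * a0 * a1))
    + u2 * (b0 * b0 * a1 + 2 * (b0 * b1 * a0)) + u3 * (3 * (b0 * b0 * b1))
    + (-1 * (2 * (a0 * r1) + a1 * q1) + (2 * (b0 * r0) + b1 * q0))
  | 2%N => u0 * (3 * (a0 * a1 * a1)) + u1 * (b0 * a1 * a1 + 2 * (b1 * a0 * a1))
    + u2 * (b1 * b1 * a0 + 2 * (b0 * b1 * a1)) + u3 * (3 * (b0 * b1 * b1))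
    + (-1 * (a0 * s1 + 2 * (a1 * r1)) + (b0 * s0 + 2 * (b1 * r0)))
  | _ => u0 * (a1 * a1 * a1) + u1 * (b1 * a1 * a1) + u2 * (b1 * b1 * a1)
    + u3 * (b1 * b1 * b1) + (-1 * (a1 * s1) + b1 * s0)
  end.
Proof.
(* Once the cubic is expanded in powers of the variable, one ring identity settles its four
   coefficients together. *)
have cubic (P : {poly R}) c0 c1 c2 c3 :
    P = c0%:P + c1%:P * 'X + c2%:P * 'X^2 + c3%:P * 'X^3 ->
    P`_m = match m : nat with 0%N => c0 | 1%N => c1 | 2%N => c2 | _ => c3 end.
  move=> ->; rewrite !coefD !coefCM coefC coefX !coefXn.
  by case: m => -[|[|[|[|//]]]] Hm; rewrite /= ?mulr1 ?mulr0 ?addr0 ?add0r.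
by move=> A B; apply: cubic; rewrite /A /B -!mul_polyC; ring.
Qed.

Lemma point_lift_exp (R : realType) (f g : 'rV[R]_2 -> 'rV[R]_2)
    (S : 'rV[R]_2 -> 'rV[R]_4) (q : 'rV[R]_2) :
  f (g q) = q ->
  (point_lift f g (g q, S (g q))).2 = \row_(m < 4) peval (lift_env g S q) (lift_exp R m).
Proof.
move=> fgq; apply/rowP => m; rewrite !mxE /= fgq.
rewrite !big_ord_recl big_ord0 /=.
have SE (i : 'I_4) (k : nat) : (i : nat) = k -> S (g q) 0 i = S (g q) 0 (inord k).
  by move=> <-; rewrite inord_val.
rewrite (SE ord0 0)// (SE (lift ord0 ord0) 1)// (SE (lift ord0 (lift ord0 ord0)) 2%N)//.
rewrite (SE (lift ord0 (lift ord0 (lift ord0 ord0))) 3%N)//.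
rewrite /lift_exp /= /lift_env /=.
rewrite -!/(cdir R false) -!/(cdir R true).
rewrite /pderiv /=.
rewrite -!/(cdir R false) -!/(cdir R true).
rewrite coefZ; congr (_ * _).
rewrite /bump /= !add1n subn0 (_ : 3 - 1 = 2)%N// (_ : 3 - 2 = 1)%N// subnn.
rewrite lift_poly_coef.
by case: m => -[|[|[|[|//]]]] Hm.
Qed.

(** Split off from [lshift] so that the rule for 1/J can refer to the derivative of J without
    recursion. *)
Definition jshift (R : realType) (k : bool) (n : lvar) : pexp lvar R :=
  if n is VG i j w then PV (VG i j (k :: w)) else PC 0.

(* Here [c m j] stands for the j-th partial derivative of the coefficient [VU m]. *)
Definition lshift (R : realType) (c : nat -> bool -> R) (k : bool) (n : lvar) :
    pexp lvar R :=
  match n with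
  | VG i j w => PV (VG i j (k :: w))
  | VU m => PC (c m false) * PV (VG false k [::]) + PC (c m true) * PV (VG true k [::])
  | VK => PC (-1) * (PV VK * PV VK * pdiff (@jshift R k) (Jexp R))
  end%P.

Lemma is_derive_inv (R : realType) (V : normedModType R) (f : V -> R) (x v : V)
    (df : R) :
  is_derive x v f df -> f x != 0 ->
  is_derive x v (fun y => (f y)^-1) (- ((f x)^-1 * (f x)^-1 * df)).
Proof.
move=> [dfx <-] fx0; apply: DeriveDef; first exact: derivableV.
by rewrite deriveV// expr2 invfM scaleNr.
Qed.

Lemma is_derive_diff (R : realType) (V W : normedModType R) (f : V -> W)
    (x v : V) : differentiable f x -> is_derive x v f ('D_v f x).
Proof. by move=> df; apply: derivableP; exact: diff_derivable. Qed.

Lemma Jexp_eval (R : realType) (g : 'rV[R]_2 -> 'rV[R]_2)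
    (S : 'rV[R]_2 -> 'rV[R]_4) (q : 'rV[R]_2) :
  lift_env g S q VK = (peval (lift_env g S q) (Jexp R))^-1.
Proof. by rewrite /= mulN1r. Qed.

Lemma is_derive_lift_env (R : realType) (V : set 'rV[R]_2)
    (g : 'rV[R]_2 -> 'rV[R]_2) (S : 'rV[R]_2 -> 'rV[R]_4) (q : 'rV[R]_2)
    (k : bool) (n : lvar) :
  smooth_on V g -> V q -> differentiable S (g q) ->
  peval (lift_env g S q) (Jexp R) != 0 ->
  is_derive q (cdir R k) (fun y => lift_env g S y n)
    (peval (lift_env g S q)
       (lshift (fun m b => 'D_(cdir R b) S (g q) 0 (inord m)) k n)).
Proof.
move=> sg Vq dS J0.
have HG i j w : is_derive q (cdir R k) (fun y => lift_env g S y (VG i j w))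
    (lift_env g S q (VG i j (k :: w))).
  have sgj := smooth_on_foldr (wd R w) (smooth_on_derive (cdir R j) sg).
  have dgj := smooth_on_diff sgj Vq.
  exact: ((is_derive_mxP _ _ _ _).1 (is_derive_diff (cdir R k) dgj) 0 (ob i)).
case: n => [i j w|m|]; first exact: HG.
- have dg := smooth_on_diff sg Vq.
  have dSg : differentiable (S \o g) q by exact: differentiable_comp.
  have := (is_derive_mxP _ _ _ _).1
    (is_derive_diff (cdir R k) dSg) 0 (inord m).
  move=> H; apply: (is_derive_eq H).
  have dgE : 'd g q (cdir R k) = 'D_(cdir R k) g q by rewrite deriveE.
  rewrite deriveE// diff_comp//= dgE -(@deriveE _ _ _ _ _ _ dS).
  by rewrite derive_coords// entry_comb mulrC; congr (_ + _); rewrite mulrC.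
- have -> : (fun y => lift_env g S y VK) =
      (fun y => (peval (lift_env g S y) (Jexp R))^-1).
    by apply/funext => y; rewrite Jexp_eval.
  have HJ : is_derive q (cdir R k) (fun y => peval (lift_env g S y) (Jexp R))
     (peval (lift_env g S q) (pdiff (@jshift R k) (Jexp R))).
    (* J is a polynomial in the [VG] variables alone. Cutting the environment down to them avoids a
       circular appeal to the derivative of 1/J. *)
    pose env y n := if n is VG _ _ _ then lift_env g S y n else 0.
    have H : is_derive q (cdir R k) (fun y => peval (env y) (Jexp R))
        (peval (env q) (pdiff (@jshift R k) (Jexp R))).
      apply: is_derive_peval => -[i j w|m|] /=; first exact: HG.
        exact: (@is_derive_cst R _ R).
      exact: (@is_derive_cst R _ R).
    exact: H.
  have H := is_derive_inv HJ J0; apply: (is_derive_eq H).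
  transitivity (-1 * (lift_env g S q VK * lift_env g S q VK
    * peval (lift_env g S q) (pdiff (@jshift R k) (Jexp R)))); last by [].
  by rewrite Jexp_eval mulN1r.
Qed.

(** Rates at t = 0 of the variables of the lift by F_t, taken at F_t p. Since J has value 1 and rate
    - div X there, 1/J has rate div X. *)
Definition flow_rate (R : realType) (X : 'rV[R]_2 -> 'rV[R]_2) (p : 'rV[R]_2)
    (n : lvar) : R :=
  let jt i j w := Dw (wd R w) ('D_(cdir R j) X) p 0 (ob i) in
  match n with
  | VG i j w => - jt i j w
  | VU m => 0
  | VK => jt false false [::] + jt true true [::]
  end.

Definition id_env (R : realType) (u : 'rV[R]_4) (n : lvar) : R :=
  match n with
  | VG false false [::] | VG true true [::] | VK => 1
  | VG _ _ _ => 0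
  | VU m => u 0 (inord m)
  end.

Lemma peval_ext (T : Type) (R : pzRingType) (env env' : T -> R) (e : pexp T R) :
  env =1 env' -> peval env e = peval env' e.
Proof. by move=> /funext ->. Qed.

Lemma lift_env_id (R : realType) (S : 'rV[R]_2 -> 'rV[R]_4) (p : 'rV[R]_2) :
  lift_env id S p =1 id_env (S p).
Proof.
have D1 b (y : 'rV[R]_2) : 'D_(cdir R b) id y = cdir R b by exact: derive_id.
case=> [i j [|k w]|m|] //=.
- by rewrite D1; case: i; case: j; rewrite !mxE /=.
- have -> : Dw (wd R (k :: w)) ('D_(cdir R j) id) p 0 (ob i) = 0.
    have -> : 'D_(cdir R j) id = cst (cdir R j) by apply/funext => y; exact: D1.
    by rewrite (Dw_cst (cdir R j) (wd R w) (cdir R k) p) mxE.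
  by case: i; case: j.
- by rewrite !D1 !mxE /= mulr0 subr0 mulr1 invr1.
Qed.

Lemma near_neq0 (R : realType) (f : R -> R) (x : R) :
  {for x, continuous f} -> f x != 0 -> \forall t \near x, f t != 0.
Proof.
move=> /cvgrPdist_lt cf fx0; have := cf `|f x|; rewrite normr_gt0 => /(_ fx0).
by apply: filterS => t; apply: contraTneq => ->; rewrite subr0 ltxx.
Qed.

(** * The lifted section along a trajectory of the flow *)

Section FlowLift.
Variables (R : realType) (X : 'rV[R]_2 -> 'rV[R]_2) (D : set (R * 'rV[R]_2)).
Variables (F : R -> 'rV[R]_2 -> 'rV[R]_2) (S : 'rV[R]_2 -> 'rV[R]_4) (p : 'rV[R]_2).
Hypotheses (flowF : is_flow X D F) (dS : differentiable S p).

Let env t := lift_env (F (- t)) S (F t p).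

Lemma flow0 : F 0 = id.
Proof. by case: flowF => _ _ F0 _ _; apply/funext => x; rewrite F0. Qed.

Lemma env0 : env 0 =1 id_env (S p).
Proof. by move=> n; rewrite /env oppr0 flow0 lift_env_id. Qed.

Lemma near_flow_domain : \forall t \near (0 : R), D (t, p).
Proof.
case: flowF => -[oD HD] _ _ _ _.
have : nbhs ((0, p) : R * 'rV[R]_2) D by apply: open_nbhs_nbhs; split=> //; case: (HD p).
case=> -[A B] /= [A0 Bp] AB; apply: filterS A0 => t At; apply: (AB (t, p)); split=> //=.
exact: nbhs_singleton.
Qed.

Lemma flow_inverse t : D (t, p) ->
  [/\ open [set x | D (- t, x)], D (- t, F t p), F (- t) (F t p) = p,
      smooth_on [set x | D (- t, x)] (F (- t)) &
      forall y, D (- t, y) -> F t (F (- t) y) = y].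
Proof.
case: flowF => _ _ _ _ /(_ t)[[_ oV] [_ sg] [UV _] [gf fg]] Dtp.
by split=> //; [exact: UV|exact: gf].
Qed.

Lemma is_derive_env_jet i j w :
  is_derive (0 : R) (1 : R) (fun t => env t (VG i j w)) (flow_rate X p (VG i j w)).
Proof.
have H := @is_derive_flow_jet R X D F p (wd R w ++ [:: cdir R j]) flowF.
have /H{H} : wd R w ++ [:: cdir R j] != [::] by case: (wd R w).
move/is_derive_mxP => /(_ 0 (ob i)).
have -> : (fun t => Dw (wd R w ++ [:: cdir R j]) (F (- t)) (F t p) 0 (ob i))
   = (fun t => env t (VG i j w)) by apply/funext => t; rewrite foldr_cat.
by rewrite foldr_cat mxE.
Qed.

Lemma is_derive_env_Jexp :
  is_derive (0 : R) (1 : R) (fun t => peval (env t) (Jexp R))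
    (- flow_rate X p VK).
Proof.
have HJ : is_derive (0 : R) (1 : R) (fun t => peval (env t) (Jexp R))
   (peval (env 0) (pdiff (fun n => PC (flow_rate X p n)) (Jexp R))).
  pose env' t n := if n is VG _ _ _ then env t n else 0.
  pose rate' n := if n is VG _ _ _ then flow_rate X p n else 0.
  have H : is_derive (0 : R) (1 : R) (fun t => peval (env' t) (Jexp R))
      (peval (env' 0) (pdiff (fun n => PC (rate' n)) (Jexp R))).
    apply: is_derive_peval => -[i j w|m|] /=; first exact: is_derive_env_jet.
      exact: (@is_derive_cst R R R).
    exact: (@is_derive_cst R R R).
  exact: H.
apply: (is_derive_eq HJ).
rewrite (peval_ext _ env0) /=.
move: ('D_(cdir R false) X p) ('D_(cdir R true) X p) => a b.
move: (a 0 0) (b 0 0) (a 0 1) (b 0 1) => a0 b0 a1 b1; ring.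
Qed.

Lemma is_derive_env n :
  is_derive (0 : R) (1 : R) (fun t => env t n) (flow_rate X p n).
Proof.
case: n => [i j w|m|]; first exact: is_derive_env_jet.
  have := @is_derive_cst R R R (S p 0 (inord m)) 0 1.
  apply: near_eq_is_derive; apply: filterS near_flow_domain => t /flow_inverse[_ _ gf _ _].
  by rewrite /env /= gf.
have -> : (fun t => env t VK) = (fun t => (peval (env t) (Jexp R))^-1).
  by apply/funext => t; rewrite /env Jexp_eval.
have J1 : peval (env 0) (Jexp R) = 1.
  by rewrite (peval_ext _ env0) /= mulr0 mulr0 addr0 mulr1.
have J0 : peval (env 0) (Jexp R) != 0 by rewrite J1 oner_neq0.
have H := is_derive_inv is_derive_env_Jexp J0; apply: (is_derive_eq H).
by rewrite J1 invr1 !mul1r opprK.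
Qed.

Lemma is_derive_peval_env e :
  is_derive (0 : R) (1 : R) (fun t => peval (env t) e)
    (peval (id_env (S p)) (pdiff (fun n => PC (flow_rate X p n)) e)).
Proof.
rewrite -(peval_ext _ env0).
apply: (@is_derive_peval R R lvar env (fun n => PC (flow_rate X p n))).
exact: is_derive_env.
Qed.

(** Differentiating 1/J in the base at F_t p requires J to be nonzero there; small t suffice for a
    derivative at t = 0. *)
Lemma near_Jexp_neq0 : \forall t \near (0 : R), peval (env t) (Jexp R) != 0.
Proof.
have cJ : {for (0 : R), continuous (fun t => peval (env t) (Jexp R))}.
  apply: differentiable_continuous; apply/derivable1_diffP.
  by case: is_derive_env_Jexp.
have J1 : peval (env 0) (Jexp R) = 1.
  by rewrite (peval_ext _ env0) /= mulr0 mulr0 addr0 mulr1.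
by apply: near_neq0 cJ _; rewrite J1 oner_neq0.
Qed.

Definition lifted t (q : 'rV[R]_2) : 'rV[R]_4 :=
  (point_lift (F t) (F (- t)) (F (- t) q, S (F (- t) q))).2.

Definition dS_coef m b : R := 'D_(cdir R b) S p 0 (inord m).

(** The symbolic formula is needed on a neighbourhood of F_t p, not only at this point, because it
    is then differentiated in the base. *)
Lemma lifted_near t : D (t, p) -> \forall y \near F t p,
  lifted t y = \row_(m < 4) peval (lift_env (F (- t)) S y) (lift_exp R m).
Proof.
move=> /flow_inverse[oV Vq _ _ fg].
have : nbhs (F t p) [set x | D (- t, x)] by exact: open_nbhs_nbhs.
by apply: filterS => y /fg; exact: point_lift_exp.
Qed.

Lemma is_derive_lifted (m : 'I_4) :
  is_derive (0 : R) (1 : R) (fun t => lifted t (F t p) 0 m)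
    (peval (id_env (S p)) (pdiff (fun n => PC (flow_rate X p n)) (lift_exp R m))).
Proof.
apply: near_eq_is_derive (is_derive_peval_env _).
apply: filterS near_flow_domain => t /lifted_near/nbhs_singleton ->.
by rewrite mxE.
Qed.

(** The base derivative is taken symbolically for each small t, and only then the rate in t. Along
    this curve S is always differentiated at F_{-t} (F_t p) = p, so its derivatives enter as the
    constants [dS_coef]. *)
Lemma is_derive_derive_lifted (k : bool) (m : 'I_4) :
  is_derive (0 : R) (1 : R) (fun t => 'D_(cdir R k) (lifted t) (F t p) 0 m)
    (peval (id_env (S p)) (pdiff (fun n => PC (flow_rate X p n))
       (pdiff (lshift dS_coef k) (lift_exp R m)))).
Proof.
apply: near_eq_is_derive (is_derive_peval_env _).
move: near_flow_domain near_Jexp_neq0; apply: filterS2 => t Dtp J0.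
rewrite (near_eq_derive _ (lifted_near Dtp)).
have [_ Vq gf sg _] := flow_inverse Dtp.
set G := (fun y => \row_(_ < 4) _).
have /(@derive_val _ _ _ _ _ G) -> : is_derive (F t p) (cdir R k) G
  (\row_(i < 4) peval (env t) (pdiff (lshift dS_coef k) (lift_exp R i))).
  apply/is_derive_mxP => i j; rewrite mxE.
  have -> : (fun y => G y i j) =
    (fun y => peval (lift_env (F (- t)) S y) (lift_exp R j)).
    by apply/funext => y; rewrite mxE.
  apply: is_derive_peval => n.
  have := @is_derive_lift_env R _ (F (- t)) S (F t p) k n sg Vq.
  by rewrite gf; apply.
by rewrite mxE.
Qed.

End FlowLift.

(** * Taylor polynomials and coefficients of jets *)

(** A class of differentiable functions stable under directional derivatives, hence consisting of
    smooth functions; it contains the components of Taylor polynomials. *)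
Inductive poly_fun (R : realType) : ('rV[R]_2 -> R) -> Prop :=
  | poly_cst c : poly_fun (fun=> c)
  | poly_coord i : poly_fun (fun x => x 0 i)
  | poly_add f g : poly_fun f -> poly_fun g -> poly_fun (fun x => f x + g x)
  | poly_mul f g : poly_fun f -> poly_fun g -> poly_fun (fun x => f x * g x).

Lemma poly_fun_diff (R : realType) (f : 'rV[R]_2 -> R) (x : 'rV[R]_2) :
  poly_fun f -> differentiable f x.
Proof.
elim=> {f} [c|i|f g _ df _ dg|f g _ df _ dg].
- exact: differentiable_cst.
- exact: differentiable_coord.
- exact: differentiableD.
- exact: differentiableM.
Qed.

Lemma is_derive_coord (R : realType) (x v : 'rV[R]_2) (i : 'I_2) :
  is_derive x v (fun y => y 0 i) (v 0 i).
Proof. exact: ((is_derive_mxP id x v v).1 (is_derive_id x v)). Qed.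

Lemma poly_fun_derive (R : realType) (f : 'rV[R]_2 -> R) (v : 'rV[R]_2) :
  poly_fun f -> poly_fun ('D_v f).
Proof.
elim=> {f} [c|i|f g pf pdf pg pdg|f g pf pdf pg pdg].
- have -> : 'D_v (fun=> c) = (fun=> 0) by apply/funext => x; exact: derive_cst.
  exact: poly_cst.
- have -> : 'D_v (fun x : 'rV[R]_2 => x 0 i) = (fun=> v 0 i).
    by apply/funext => x; have [] := is_derive_coord x v i.
  exact: poly_cst.
- have -> : 'D_v (fun x => f x + g x) = (fun x => 'D_v f x + 'D_v g x).
    by apply/funext => x; apply: deriveD; apply: diff_derivable; exact: poly_fun_diff.
  exact: poly_add.
- have -> : 'D_v (fun x => f x * g x) = (fun x => f x * 'D_v g x + g x * 'D_v f x).
    by apply/funext => x; apply: deriveM; apply: diff_derivable; exact: poly_fun_diff.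
  by apply: poly_add; exact: poly_mul.
Qed.

Lemma poly_fun_exp (R : realType) (f : 'rV[R]_2 -> R) (n : nat) :
  poly_fun f -> poly_fun (fun x => f x ^+ n).
Proof.
move=> pf; elim: n => [|n IHn]; first exact: poly_cst.
have -> : (fun x => f x ^+ n.+1) = (fun x => f x * f x ^+ n).
  by apply/funext => x; rewrite exprS.
exact: poly_mul.
Qed.

Lemma poly_fun_sum (R : realType) (I : Type) (r : seq I) (f : I -> 'rV[R]_2 -> R) :
  (forall i, poly_fun (f i)) -> poly_fun (fun x => \sum_(i <- r) f i x).
Proof.
move=> pf; elim: r => [|i r IHr].
  have -> : (fun x => \sum_(i <- [::]) f i x) = (fun=> 0).
    by apply/funext => x; rewrite big_nil.
  exact: poly_cst.
have -> : (fun x => \sum_(j <- i :: r) f j x) =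
    (fun x => f i x + \sum_(j <- r) f j x).
  by apply/funext => x; rewrite big_cons.
exact: poly_add.
Qed.

Lemma poly_map_diff (R : realType) (n : nat) (f : 'rV[R]_2 -> 'rV[R]_n)
    (x : 'rV[R]_2) :
  (forall i, poly_fun (fun x => f x 0 i)) -> differentiable f x.
Proof.
move=> pf.
have -> : f = \sum_(i < n) (fun y => f y 0 i *: delta_mx 0 i).
  by apply/funext => y; rewrite fct_sumE [LHS]row_sum_delta.
by apply: differentiable_sum => i; apply: differentiableZl; exact: poly_fun_diff.
Qed.

Lemma poly_map_smooth (R : realType) (n : nat) (f : 'rV[R]_2 -> 'rV[R]_n) :
  (forall i, poly_fun (fun x => f x 0 i)) -> smooth_on setT f.
Proof.
move=> pf s x _; apply: poly_map_diff; elim: s {x} => [//|v s IHs] i /=.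
have -> : (fun x => 'D_v (Dw s f) x 0 i) = 'D_v (fun x => Dw s f x 0 i).
  apply/funext => x; rewrite derive_coord//; apply: diff_derivable.
  exact: poly_map_diff.
exact: poly_fun_derive.
Qed.

Lemma taylor_smooth (R : realType) (n k : nat) (p : 'rV[R]_2)
    (xi : jet k 'rV[R]_n) : smooth_on setT (taylor p xi).
Proof.
apply: poly_map_smooth => i.
have -> : (fun x => taylor p xi x 0 i) = (fun x : 'rV[R]_2 => \sum_(al : mindex k)
   ((x 0 0 + - p 0 0) ^+ (midx al).1 * (x 0 1 + - p 0 1) ^+ (midx al).2
    * ((((midx al).1`! * (midx al).2`!)%:R)^-1 * xi al 0 i))).
  apply/funext => x; rewrite /taylor summxE; apply: eq_bigr => al _.
  by rewrite mxE mulrA.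
apply: poly_fun_sum => al.
apply: poly_mul; last exact: poly_cst.
by apply: poly_mul; apply: poly_fun_exp; apply: poly_add; (exact: poly_coord || exact: poly_cst).
Qed.

(* The a-th derivative of s^m / m!. *)
Definition divpow (R : realType) (m a : nat) (s : R) : R :=
  if (a <= m)%N then s ^+ (m - a) / (m - a)`!%:R else 0.

Lemma divpow0 (R : realType) (m a : nat) : divpow m a (0 : R) = (m == a)%:R.
Proof.
rewrite /divpow; case: ltngtP => [am|ma|->]; last by rewrite subnn expr0 divr1.
  by rewrite expr0n subn_eq0 leqNgt am mul0r.
by [].
Qed.

Lemma is_derive_divpow (R : realType) (V : normedModType R) (m a : nat)
    (f : V -> R) (x v : V) (df : R) :
  is_derive x v f df ->
  is_derive x v (fun y => divpow m a (f y)) (divpow m a.+1 (f x) * df).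
Proof.
move=> Hf; rewrite /divpow; case: (ltngtP a m) => [am|ma|->].
- have [j mE] : exists j, (m - a = j.+1)%N.
    by exists (m - a.+1)%N; rewrite subnSK.
  have -> : (m - a.+1 = j)%N by rewrite subnS mE.
  rewrite mE.
  have H := @is_deriveX _ _ f j.+1 x v df Hf.
  have H' := @is_deriveZ _ _ _ _ ((j.+1)`!%:R^-1) _ _ _ H.
  have -> : (fun y => f y ^+ j.+1 / (j.+1)`!%:R) =
    ((j.+1)`!%:R^-1) \*: (f ^+ j.+1).
    by apply/funext => y; rewrite /= fctE mulrC.
  apply: (is_derive_eq H').
  rewrite factS natrM invfM.
  have j0 : (j.+1)%:R != 0 :> R by rewrite pnatr_eq0.
  have f0 : (j`!)%:R != 0 :> R by rewrite pnatr_eq0 -lt0n fact_gt0.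
  rewrite /= /GRing.scale /=; field.
  by rewrite f0 addrC natr1 j0.
- by rewrite mul0r; exact: is_derive_cst.
- rewrite mul0r subnn; have -> : (fun y => f y ^+ 0 / (0`!)%:R) = cst 1.
    by apply/funext => y; rewrite expr0 divr1.
  exact: is_derive_cst.
Qed.

Lemma is_derive_bigsum (R : realType) (V W : normedModType R) (I : Type)
    (r : seq I) (f : I -> V -> W) (df : I -> W) (x v : V) :
  (forall i, is_derive x v (f i) (df i)) ->
  is_derive x v (fun y => \sum_(i <- r) f i y) (\sum_(i <- r) df i).
Proof.
move=> Hf; elim: r => [|i r IHr].
  have -> : (fun y => \sum_(i <- [::]) f i y) = cst 0.
    by apply/funext => y; rewrite big_nil.
  by rewrite big_nil; exact: is_derive_cst.
have -> : (fun y => \sum_(j <- i :: r) f j y) =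
    f i + (fun y => \sum_(j <- r) f j y).
  by apply/funext => y; rewrite big_cons.
by rewrite big_cons; exact: is_deriveD.
Qed.

Lemma is_derive_scale_vec (R : realType) (V W : normedModType R) (f : V -> R)
    (w : W) (x v : V) :
  differentiable f x ->
  is_derive x v (fun y => f y *: w) ('D_v f x *: w).
Proof.
move=> df; have dfw : differentiable (fun y => f y *: w) x.
  exact: differentiableZl.
apply: DeriveDef; first exact: diff_derivable.
by rewrite !deriveE// diffZl.
Qed.

Definition mi (k a b : nat) (le_ab : (a + b <= k)%N) : mindex k :=
  exist _ (Ordinal (leq_trans (leq_addr b a) le_ab : (a < k.+1)%N),
           Ordinal (leq_trans (leq_addl a b) le_ab : (b < k.+1)%N)) le_ab.

(** The sum has at most one term: it reads off the entry (a, b) without a proof that a + b <= k, and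
    gives 0 beyond order k. *)
Definition jcoef (k : nat) (V : nmodType) (xi : jet k V) (a b : nat) : V :=
  \sum_(al : mindex k | ((midx al).1 == a :> nat) && ((midx al).2 == b :> nat)) xi al.

Lemma jcoefE (k : nat) (V : nmodType) (xi : jet k V) (a b : nat)
    (le_ab : (a + b <= k)%N) : jcoef xi a b = xi (mi le_ab).
Proof.
by rewrite /jcoef (big_pred1 (mi le_ab)).
Qed.

Definition pterm (R : realType) (k : nat) (p : 'rV[R]_2) (al : mindex k) (a b : nat)
    (x : 'rV[R]_2) : R :=
  divpow (midx al).1 a (x 0 0 - p 0 0) * divpow (midx al).2 b (x 0 1 - p 0 1).

Lemma is_derive_shift_coord (R : realType) (x v c : 'rV[R]_2) (i : 'I_2) :
  is_derive x v (fun y => y 0 i - c 0 i) (v 0 i).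
Proof.
have H := is_deriveB (is_derive_coord x v i) (is_derive_cst (c 0 i) x v).
by apply: (is_derive_eq H); rewrite subr0.
Qed.

Lemma is_derive_pterm (R : realType) (k : nat) (p : 'rV[R]_2) (al : mindex k)
    (a b : nat) (x v : 'rV[R]_2) :
  is_derive x v (pterm p al a b)
    (v 0 0 * pterm p al a.+1 b x + v 0 1 * pterm p al a b.+1 x).
Proof.
have H0 := is_derive_divpow (midx al).1 a (is_derive_shift_coord x v p 0).
have H1 := is_derive_divpow (midx al).2 b (is_derive_shift_coord x v p 1).
have H := is_deriveM H0 H1.
by apply: (is_derive_eq H); rewrite /GRing.scale /= /pterm; ring.
Qed.

Lemma poly_fun_divpow (R : realType) (m a : nat) (f : 'rV[R]_2 -> R) :
  poly_fun f -> poly_fun (fun x => divpow m a (f x)).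
Proof.
rewrite /divpow => pf; case: (a <= m)%N; last exact: poly_cst.
by apply: poly_mul; [exact: poly_fun_exp|exact: poly_cst].
Qed.

Lemma pterm_diff (R : realType) (k : nat) (p : 'rV[R]_2) (al : mindex k)
    (a b : nat) (x : 'rV[R]_2) : differentiable (pterm p al a b) x.
Proof.
apply: poly_fun_diff; apply: poly_mul; apply: poly_fun_divpow;
  by apply: poly_add; (exact: poly_coord || exact: poly_cst).
Qed.

(** With booleans coerced to 0 and 1, ~~ c + a and c + b raise exactly the exponent belonging to the
    direction c; the same coding recurs for all jets below. *)
Lemma derive_pterm_sum (R : realType) (n k : nat) (p : 'rV[R]_2)
    (xi : jet k 'rV[R]_n) (a b : nat) (c : bool) :
  'D_(cdir R c) (fun x => \sum_(al : mindex k) pterm p al a b x *: xi al) =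
  (fun x => \sum_(al : mindex k) pterm p al (~~ c + a) (c + b) x *: xi al).
Proof.
apply/funext => x; apply: derive_val.
apply: is_derive_bigsum => al.
have H := is_derive_scale_vec (xi al) (cdir R c) (pterm_diff p al a b x).
apply: (is_derive_eq H); congr (_ *: _).
have [_ ->] := is_derive_pterm p al a b x (cdir R c).
by case: c H; rewrite /cdir /coord_dir !mxE /= ?mul0r ?mul1r ?add0r ?addr0.
Qed.

Lemma pderiv_taylor (R : realType) (n k : nat) (p : 'rV[R]_2)
    (xi : jet k 'rV[R]_n) (a b : nat) :
  pderiv a b (taylor p xi) p = jcoef xi a b.
Proof.
have T0 : taylor p xi = fun x => \sum_(al : mindex k) pterm p al 0 0 x *: xi al.
  apply/funext => x; apply: eq_bigr => al _; congr (_ *: _).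
  by rewrite /pterm /divpow !subn0 /= natrM invfM mulrACA.
have Tb : iter b (fun h => 'D_(coord_dir R 1) h) (taylor p xi) =
    fun x => \sum_(al : mindex k) pterm p al 0 b x *: xi al.
  by elim: b => [//|b /= ->]; exact: (derive_pterm_sum p xi 0 b true).
have Tab : pderiv a b (taylor p xi) =
    fun x => \sum_(al : mindex k) pterm p al a b x *: xi al.
  rewrite /pderiv Tb; elim: a => [//|a /= ->].
  exact: (derive_pterm_sum p xi a b false).
rewrite Tab /jcoef [RHS]big_mkcond; apply: eq_bigr => al _.
rewrite /pterm !subrr !divpow0.
by case: eqP => _; case: eqP => _; rewrite /= ?mul1r ?mul0r ?mulr0 ?scale1r ?scale0r.
Qed.

Lemma jet_at_coef (R : realType) (V : normedModType R) (k : nat) (p : 'rV[R]_2)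
    (f : 'rV[R]_2 -> V) (a b : nat) :
  (a + b <= k)%N -> jcoef (jet_at k p f) a b = pderiv a b f p.
Proof. by move=> le_ab; rewrite (jcoefE _ le_ab) ffunE. Qed.

Lemma jproj_coef (V : nmodType) (i j : nat) (le_ji : (j <= i)%N) (xi : jet i V)
    (a b : nat) :
  (a + b <= j)%N -> jcoef (jproj le_ji xi) a b = jcoef xi a b.
Proof.
move=> le_ab; rewrite (jcoefE _ le_ab) (jcoefE _ (leq_trans le_ab le_ji)) ffunE.
by congr (xi _); apply: val_inj => /=; congr (_, _); apply: val_inj.
Qed.

Lemma pderiv_smooth (R : realType) (V : normedModType R) (a b : nat)
    (f : 'rV[R]_2 -> V) : smooth_on setT f -> smooth_on setT (pderiv a b f).
Proof.
move=> sf; rewrite /pderiv; elim: a => [|a IHa] /=; last exact: smooth_on_derive.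
by elim: b => [//|b IHb] /=; exact: smooth_on_derive.
Qed.

Lemma derive_pderiv (R : realType) (n : nat) (f : 'rV[R]_2 -> 'rV[R]_n)
    (a b : nat) (c : bool) :
  smooth_on setT f -> 'D_(cdir R c) (pderiv a b f) = pderiv (~~ c + a) (c + b) f.
Proof.
(* In [pderiv] the x-derivatives are outermost, so only an additional y-derivative has to be moved
   inside, by symmetry. *)
move=> sf; case: c => //=.
rewrite /pderiv /=; have := pderiv_smooth 0 b sf.
rewrite /pderiv /=; set h := iter b _ f => sb {sf}.
elim: a => [//|a IHa] /=.
rewrite -IHa; apply/funext => x.
exact: (schwarz _ _ openT (pderiv_smooth a 0 sb) I).
Qed.

Lemma word_pderiv (R : realType) (n : nat) (f : 'rV[R]_2 -> 'rV[R]_n)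
    (w : seq bool) :
  smooth_on setT f -> Dw (wd R w) f = pderiv (count negb w) (count id w) f.
Proof.
by move=> sf; elim: w => [//|c w IHw] /=; rewrite IHw derive_pderiv.
Qed.

(** * The equations defining A_theta *)

Definition jrate (R : pzRingType) (x : bool -> nat -> nat -> R) (n : lvar) : R :=
  match n with
  | VG i j w => - x i (count negb (rcons w j)) (count id (rcons w j))
  | VU m => 0
  | VK => x false 1%N 0%N + x true 0%N 1%N
  end.

Lemma flow_rateE (R : realType) (X : 'rV[R]_2 -> 'rV[R]_2) (p : 'rV[R]_2) :
  smooth_on setT X ->
  flow_rate X p =1 jrate (fun i a b => pderiv a b X p 0 (ob i)).
Proof.
move=> sX; have W w j : Dw (wd R w) ('D_(cdir R j) X) =
    pderiv (count negb (rcons w j)) (count id (rcons w j)) X.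
  by rewrite -word_pderiv// /wd map_rcons foldr_rcons.
by case=> [i j w|m|] //=; rewrite ?W//; rewrite -/(wd R [::]) ?(W [::]).
Qed.

(** The velocity of the lifted 1-jet is computed twice: from the rates along the flow, and as a
    vector of [Kspace]. The family [x] consists of the partial derivatives of a vector field with
    3-jet [xi]. *)
Lemma Aspace_flow_equations (R : realType) (theta : Jpi R 2) (xi : vjet R 3) :
  Aspace theta xi ->
  let u m a b := jcoef theta.2 a b 0 (inord m) in
  exists2 x : bool -> nat -> nat -> R,
    forall i a b, (a + b <= 3)%N -> x i a b = jcoef xi a b 0 (ob i) &
    forall m, (m < 4)%N ->
    (peval (id_env (jcoef theta.2 0 0)) (pdiff (fun n => PC (jrate x n)) (lift_exp R m))
       = x false 0%N 0%N * u m 1%N 0%N + x true 0%N 0%N * u m 0%N 1%N) /\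
    forall k : bool,
    (peval (id_env (jcoef theta.2 0 0)) (pdiff (fun n => PC (jrate x n))
        (pdiff (lshift (fun m b => u m (~~ b) b) k) (lift_exp R m)))
      = x false 0%N 0%N * u m (~~ k).+1 k + x true 0%N 0%N * u m (~~ k) k.+1).
Proof.
case=> X [sX jX [v [D [F [flowF vel]]] [w vE]]] u.
exists (fun i a b => pderiv a b X theta.1 0 (ob i)).
  by move=> i a b ab; rewrite -jX jet_at_coef.
move=> m m4; pose p := theta.1.
(* The flow lifts the 1-jet, represented by [S1], while [Kspace] differentiates the representative
   [S2] of the full 2-jet; at p the two agree to first order. *)
pose S1 := section_of (Jproj (leqnSn 1) theta).
pose S2 := section_of theta.
have sS1 : smooth_on setT S1 by exact: taylor_smooth.
have sS2 : smooth_on setT S2 by exact: taylor_smooth.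
have dS1 : differentiable S1 p by exact: smooth_on_diff sS1 I.
have S1E a b : (a + b <= 1)%N -> pderiv a b S1 p = jcoef theta.2 a b.
  by move=> ab; rewrite /S1 /section_of pderiv_taylor /= jproj_coef.
have S10 : S1 p = jcoef theta.2 0 0 by rewrite -(S1E 0%N 0%N).
have cE : @dS_coef R S1 p = fun m b => u m (~~ b : nat) (b : nat).
  apply/funext => i; apply/funext => b; rewrite /dS_coef /u -S1E; last by case: b.
  by case: b.
have F0 : F 0 = id by exact: flow0 flowF.
(* The base component of the velocity is that of t |-> F_t p, which fixes the direction of the
   tangent vector in [Kspace]. *)
have wE : w = X p.
  have [/= Dw1 <-] : is_derive (0 : R) (1 : R) (fun s => F s p) w.
    by have [+ _] := vel; rewrite vE.
  have [[_ HD] _ _ dF _] := flowF.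
  have D0 : D (0, p) by have [] := HD p.
  by have [_ ->] := dF 0 p D0; rewrite F0.
have velE (al : mindex 1) : is_derive (0 : R) (1 : R)
    (fun t => pderiv (midx al).1 (midx al).2 (lifted F S1 t) (F t p) 0 (inord m))
    ('D_(X p) (pderiv (midx al).1 (midx al).2 S2) p 0 (inord m)).
  have [_ /(_ al)] := vel; rewrite vE wE /= ffunE.
  move/is_derive_mxP => /(_ 0 (inord m)).
  have -> : (fun y => (liftk (F y) (F (- y)) (Jproj (leqnSn 1) theta)).2 al 0 (inord m))
    = (fun t => pderiv (midx al).1 (midx al).2 (lifted F S1 t) (F t p) 0 (inord m)).
    by apply/funext => t; rewrite /liftk /jS /= ffunE.
  by [].
have uniq f (d d' : R) : is_derive (0 : R) (1 : R) f d ->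
    is_derive (0 : R) (1 : R) f d' -> d = d' by move=> [_ <-] [_ <-].
have rhs a b : 'D_(X p) (pderiv a b S2) p 0 (inord m) =
    X p 0 0 * u m a.+1 b + X p 0 1 * u m a b.+1.
  have sp : differentiable (pderiv a b S2) p.
    exact: smooth_on_diff (pderiv_smooth a b sS2) I.
  rewrite derive_coords// entry_comb.
  have dE c : 'D_(cdir R c) (pderiv a b S2) p = jcoef theta.2 (~~ c + a) (c + b).
    rewrite -[RHS](pderiv_taylor p).
    by rewrite -[in RHS](derive_pderiv a b c sS2).
  by rewrite (dE false) (dE true).
have mE : nat_of_ord (inord m : 'I_4) = m by rewrite inordK.
have frE : (fun n => PC (flow_rate X p n)) =
   (fun n => PC (jrate (fun i a b => pderiv a b X p 0 (ob i)) n) : pexp lvar R).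
  by apply/funext => n; rewrite flow_rateE.
split.
  have := uniq _ _ _ (velE (@mi 1 0 0 isT)) (@is_derive_lifted R X D F S1 p flowF (inord m)).
  by rewrite rhs S10 mE frE => <-.
move=> k.
have := @is_derive_derive_lifted R X D F S1 p flowF dS1 k (inord m).
rewrite S10 mE frE cE => H.
case: k H => H.
  by rewrite -(uniq _ _ _ (velE (@mi 1 0 1 isT)) H) rhs.
by rewrite -(uniq _ _ _ (velE (@mi 1 1 0 isT)) H) rhs.
Qed.

(* [JX i a b] and [JY i a b] are the derivatives d_x^a d_y^b of the i-th component
   of two vector fields X and Y, and [JU m a b] those of the coefficient u^(m+1). *)
Inductive jvar : Type := JX of bool & nat & nat | JY of bool & nat & nat
  | JU of nat & nat & nat.

Definition jvshift (R : pzRingType) (k : bool) (n : jvar) : pexp jvar R :=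
  match n with
  | JX i a b => PV (JX i (~~ k + a) (k + b))
  | JY i a b => PV (JY i (~~ k + a) (k + b))
  | JU m a b => PV (JU m (~~ k + a) (k + b))
  end.

Definition jdiff (R : pzRingType) (k : bool) : pexp jvar R -> pexp jvar R :=
  pdiff (@jvshift R k).

Definition jenv (R : pzRingType) (x y : bool -> nat -> nat -> R)
    (u : nat -> nat -> nat -> R) (n : jvar) : R :=
  match n with
  | JX i a b => x i a b
  | JY i a b => y i a b
  | JU m a b => u m a b
  end.

(* The infinitesimal action of X on the equation with coefficients u; its
   vanishing means that X is a symmetry of the equation. *)
Definition sym_exp (R : pzRingType) (m : nat) : pexp jvar R :=
  let u0 := PV (JU 0 0 0) in let u1 := PV (JU 1 0 0) in
  let u2 := PV (JU 2 0 0) in let u3 := PV (JU 3 0 0) in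
  let a0 := PV (JX false 1 0) in
  let a1 := PV (JX false 0 1) in
  let b0 := PV (JX true 1 0) in
  let b1 := PV (JX true 0 1) in
  let n2 := PC 2 in let n3 := PC 3 in
  let neg e := (PC (-1) * e)%P in
  let transport := neg (PV (JX false 0 0) * PV (JU m 1 0)
                        + PV (JX true 0 0) * PV (JU m 0 1))%P in
  ((a0 + b1) * PV (JU m 0 0) + transport +
  match m with
  | 0 => neg (u1 * b0 + n3 * (u0 * a0)) + PV (JX true 2 0)
  | 1 => neg (n2 * (u2 * b0) + u1 * b1 + n2 * (u1 * a0) + n3 * (u0 * a1))
         + n2 * PV (JX true 1 1) + neg (PV (JX false 2 0))
  | 2 => neg (n3 * (u3 * b0) + n2 * (u2 * b1) + u2 * a0 + n2 * (u1 * a1))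
         + PV (JX true 0 2) + neg (n2 * PV (JX false 1 1))
  | _ => neg (n3 * (u3 * b1) + u2 * a1) + neg (PV (JX false 0 2))
  end)%P.

Definition sym_jet (R : pzRingType) (x : bool -> nat -> nat -> R)
    (u : nat -> nat -> nat -> R) : Prop :=
  forall m, (m < 4)%N ->
    peval (jenv x x u) (sym_exp R m) = 0 /\
    forall k, peval (jenv x x u) (jdiff k (sym_exp R m)) = 0.

Lemma sym_jet_ext (R : pzRingType) (x x' : bool -> nat -> nat -> R)
    (u : nat -> nat -> nat -> R) :
  (forall i a b, (a + b <= 3)%N -> x i a b = x' i a b) ->
  sym_jet x u -> sym_jet x' u.
Proof.
move=> xx' Hx m m4; have [E0 E1] := Hx m m4.
split=> [|k].
  by move: E0; case: m m4 {E1} => [|[|[|[|//]]]] _ /=; rewrite !xx'.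
by move: (E1 k); case: k; case: m m4 {E0 E1} => [|[|[|[|//]]]] _ /=; rewrite !xx'.
Qed.

Definition jx (R : realType) (k : nat) (xi : vjet R k) (i : bool) (a b : nat) : R :=
  jcoef xi a b 0 (ob i).

(** At the identity the differentiated lift reduces by computation to the terms of [sym_exp] and of
    its base derivatives; only a linear rearrangement remains. *)
Lemma Aspace_sym_jet (R : realType) (theta : Jpi R 2) (xi : vjet R 3) :
  Aspace theta xi ->
  sym_jet (jx xi) (fun m a b => jcoef theta.2 a b 0 (inord m)).
Proof.
case/Aspace_flow_equations => x xE H; apply: (sym_jet_ext xE).
move: (jcoef theta.2) H => u H m m4; have [E0 E1] := H m m4.
split=> [|k].
  move: E0; case: m m4 {E1 H} => [|[|[|[|//]]]] _ /=; lra.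
by move: (E1 k); case: k; case: m m4 {E0 E1 H} => [|[|[|[|//]]]] _ /=; lra.
Qed.

(** * Brackets of jets *)

Definition lie_exp (R : pzRingType) (i : bool) : pexp jvar R :=
  (PV (JX false 0 0) * PV (JY i 1 0) + PV (JX true 0 0) * PV (JY i 0 1)
   + PC (-1) * (PV (JY false 0 0) * PV (JX i 1 0) + PV (JY true 0 0) * PV (JX i 0 1)))%P.

Definition jet_exp (R : pzRingType) (a b : nat) (e : pexp jvar R) : pexp jvar R :=
  iter a (jdiff false) (iter b (jdiff true) e).

(** Jets of a bracket as explicit polynomials in the jets of its factors, so that bilinearity,
    antisymmetry and the curvature identities become algebra. *)
Definition lie_coef (R : pzRingType) (x y : bool -> nat -> nat -> R) (i : bool)
    (a b : nat) : R :=
  peval (jenv x y (fun _ _ _ => 0)) (jet_exp a b (lie_exp R i)).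

Section LieBracket.
Variables (R : realType) (X Y : 'rV[R]_2 -> 'rV[R]_2).
Hypotheses (sX : smooth_on setT X) (sY : smooth_on setT Y).

Let E z := jenv (fun i a b => pderiv a b X z 0 (ob i))
  (fun i a b => pderiv a b Y z 0 (ob i)) (fun _ _ _ => 0).

Lemma is_derive_pderiv_entry (f : 'rV[R]_2 -> 'rV[R]_2) (a b : nat) (k i : bool) z :
  smooth_on setT f ->
  is_derive z (cdir R k) (fun z => pderiv a b f z 0 (ob i))
    (pderiv (~~ k + a) (k + b) f z 0 (ob i)).
Proof.
move=> sf; rewrite -(derive_pderiv a b k sf).
have df := smooth_on_diff (pderiv_smooth a b sf) (I : setT z).
exact: ((is_derive_mxP _ _ _ _).1 (is_derive_diff (cdir R k) df) 0 (ob i)).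
Qed.

Lemma derive_row_jet (k : bool) (e : 'I_2 -> pexp jvar R) :
  'D_(cdir R k) (fun z => \row_i peval (E z) (e i)) =
  (fun z => \row_i peval (E z) (jdiff k (e i))).
Proof.
apply/funext => z; apply: derive_val; apply/is_derive_mxP => i j; rewrite mxE.
have -> : (fun y => (\row_i peval (E y) (e i)) i j) = (fun y => peval (E y) (e j)).
  by apply/funext => y; rewrite mxE.
apply: is_derive_peval => -[l a b|l a b|m a b] /=.
- exact: is_derive_pderiv_entry.
- exact: is_derive_pderiv_entry.
- exact: (@is_derive_cst R _ R).
Qed.

Lemma lie_row : lie X Y = fun z => \row_i peval (E z) (lie_exp R (i == 1)).
Proof.
apply/funext => z; apply/rowP => i; rewrite [RHS]mxE.
have dX : differentiable X z by exact: smooth_on_diff sX I.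
have dY : differentiable Y z by exact: smooth_on_diff sY I.
have iE : ob (i == 1) = i.
  by case: i => -[|[|//]] Hi; apply: val_inj.
rewrite /lie mxE [X in _ + X]mxE derive_coords// entry_comb (derive_coords _ dX) entry_comb.
by rewrite /= iE mulN1r.
Qed.

Lemma pderiv_lie (a b : nat) (i : bool) z :
  pderiv a b (lie X Y) z 0 (ob i) = peval (E z) (jet_exp a b (lie_exp R i)).
Proof.
have iterD k n (e : 'I_2 -> pexp jvar R) :
    iter n (fun h => 'D_(cdir R k) h) (fun z => \row_i peval (E z) (e i)) =
    fun z => \row_i peval (E z) (iter n (jdiff k) (e i)).
  by elim: n => [//|n IHn]; rewrite iterS IHn derive_row_jet.
rewrite /pderiv lie_row (iterD true) (iterD false).
by rewrite mxE; case: i.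
Qed.

End LieBracket.

Lemma jlie_coef (R : realType) (k : nat) (p : 'rV[R]_2) (xi eta : vjet R k.+1)
    (a b : nat) (i : bool) :
  (a + b <= k)%N ->
  jx (jlie p xi eta) i a b = lie_coef (jx xi) (jx eta) i a b.
Proof.
move=> ab; rewrite /jx jet_at_coef// pderiv_lie; try exact: taylor_smooth.
apply: peval_ext => -[l c d|l c d|m c d] //=; by rewrite pderiv_taylor.
Qed.

Lemma vjet_ext (R : realType) (k : nat) (xi eta : vjet R k) :
  (forall a b i, (a + b <= k)%N -> jx xi i a b = jx eta i a b) -> xi = eta.
Proof.
move=> H; apply/ffunP => -[[[a Ha] [b Hb]] /= ab]; apply/rowP => i.
have iE : ob (i == 1) = i.
  by case: i => -[|[|//]] Hi; apply: val_inj.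
have miE (z : vjet R k) : z (exist _ (Ordinal Ha, Ordinal Hb) ab) = jcoef z a b.
  rewrite (jcoefE _ ab); congr (z _); apply: val_inj => /=.
  by congr (_, _); apply: val_inj.
by rewrite !miE -iE; exact: H.
Qed.

Lemma jcoef_comb (R : pzRingType) (V : lmodType R) (k : nat) (xi eta : jet k V) (c : R)
    (a b : nat) :
  jcoef (c *: xi + eta) a b = c *: jcoef xi a b + jcoef eta a b.
Proof.
rewrite /jcoef scaler_sumr -big_split /=; apply: eq_bigr => al _.
by rewrite !ffunE.
Qed.

Lemma jx_comb (R : realType) (k : nat) (xi eta : vjet R k) (c : R) (i : bool)
    (a b : nat) :
  jx (c *: xi + eta) i a b = c * jx xi i a b + jx eta i a b.
Proof. by rewrite /jx jcoef_comb -[X in _ + X]scale1r entry_comb mul1r. Qed.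

Lemma jx0 (R : realType) (k : nat) (i : bool) (a b : nat) :
  jx (0 : vjet R k) i a b = 0.
Proof. by rewrite /jx /jcoef big1 ?mxE// => al _; rewrite ffunE. Qed.

Lemma lie_coef_linear (R : comPzRingType) (x x' y : bool -> nat -> nat -> R) (c : R)
    (i : bool) (a b : nat) :
  (a + b <= 2)%N ->
  lie_coef (fun i a b => c * x i a b + x' i a b) y i a b =
  c * lie_coef x y i a b + lie_coef x' y i a b.
Proof.
by move: a b => [|[|[|a]]] [|[|[|b]]] // _; rewrite /lie_coef /=; ring.
Qed.

Lemma lie_coef_anti (R : comPzRingType) (x y : bool -> nat -> nat -> R)
    (i : bool) (a b : nat) :
  (a + b <= 2)%N -> lie_coef y x i a b = - lie_coef x y i a b.
Proof.
by move: a b => [|[|[|a]]] [|[|[|b]]] // _; rewrite /lie_coef /=; ring.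
Qed.

Lemma jlie_linear (R : realType) (p : 'rV[R]_2) (c : R) (xi xi' eta : vjet R 3) :
  jlie p (c *: xi + xi') eta = c *: jlie p xi eta + jlie p xi' eta.
Proof.
move: (@jlie_coef R 2 p (c *: xi + xi') eta) (@jlie_coef R 2 p xi eta)
  (@jlie_coef R 2 p xi' eta).
move: (jlie p (c *: xi + xi') eta) (jlie p xi eta) (jlie p xi' eta) => A B C HA HB HC.
apply: vjet_ext => a b i ab; rewrite jx_comb HA// HB// HC// -lie_coef_linear//.
congr (lie_coef _ _ _ _ _).
by apply/funext => l; apply/funext => d; apply/funext => m; exact: jx_comb.
Qed.

Lemma jlie_anti (R : realType) (p : 'rV[R]_2) (xi eta : vjet R 3) :
  jlie p eta xi = - jlie p xi eta.
Proof.
move: (@jlie_coef R 2 p xi eta) (@jlie_coef R 2 p eta xi).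
move: (jlie p xi eta) (jlie p eta xi) => A B HA HB; rewrite -[- A]addr0 -scaleN1r.
apply: vjet_ext => a b i ab; rewrite jx_comb jx0 addr0 HA// HB//.
by rewrite lie_coef_anti// mulN1r.
Qed.

Lemma jlie_self (R : realType) (p : 'rV[R]_2) (xi : vjet R 3) : jlie p xi xi = 0.
Proof.
have /eqP := jlie_anti p xi xi; rewrite -subr_eq0 opprK.
have -> : jlie p xi xi + jlie p xi xi = 2%:R *: jlie p xi xi.
  by rewrite scaler_nat mulr2n.
by rewrite scaler_eq0 pnatr_eq0 /= => /eqP.
Qed.

(** * Liouville invariants *)
Section Curvature.
Variables (R : realFieldType) (x y : bool -> nat -> nat -> R) (u : nat -> nat -> nat -> R).

Local Notation "'u[' m ; a , b ]" := (u m%N a%N b%N).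
Local Notation "'x1[' a , b ]" := (x false a%N b%N).
Local Notation "'x2[' a , b ]" := (x true a%N b%N).
Local Notation "'y1[' a , b ]" := (y false a%N b%N).
Local Notation "'y2[' a , b ]" := (y true a%N b%N).

(* Liouville's relative invariants of the equation, up to constant factors. *)
Definition liouville1 : R :=
  u[0; 0, 2] - 2 / 3 * u[1; 1, 1] + 1 / 3 * u[2; 2, 0] - u[0; 0, 0] * u[2; 0, 1] + 2 *
  u[0; 0, 0] * u[3; 1, 0] - u[0; 0, 1] * u[2; 0, 0] + u[0; 1, 0] * u[3; 0, 0] + 2 / 3 *
  u[1; 0, 0] * u[1; 0, 1] - 1 / 3 * u[1; 0, 0] * u[2; 1, 0].

Definition liouville2 : R :=
  1 / 3 * u[1; 0, 2] - 2 / 3 * u[2; 1, 1] + u[3; 2, 0] - u[0; 0, 0] * u[3; 0, 1] - 2 *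
  u[0; 0, 1] * u[3; 0, 0] + u[1; 0, 0] * u[3; 1, 0] + 1 / 3 * u[1; 0, 1] * u[2; 0, 0] +
  u[1; 1, 0] * u[3; 0, 0] - 2 / 3 * u[2; 0, 0] * u[2; 1, 0].

Hypotheses (sx : sym_jet x u) (sy : sym_jet y u).
Hypotheses (x10 : x1[0, 0] = 1) (x20 : x2[0, 0] = 0).
Hypotheses (y10 : y1[0, 0] = 0) (y20 : y2[0, 0] = 1).

Local Notation B := (lie_coef x y).
Hypothesis B0 : forall i a b, (a + b <= 1)%N -> B i a b = 0.

Let Ex m := peval (jenv x x u) (sym_exp R m).
Let Dx k m := peval (jenv x x u) (jdiff k (sym_exp R m)).
Let Ey m := peval (jenv y y u) (sym_exp R m).
Let Dy k m := peval (jenv y y u) (jdiff k (sym_exp R m)).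

(** As X and Y take the coordinate vectors as values at p, the value of [X, Y] there is d_x Y - d_y
    X. *)
Lemma torsion1 : y1[1, 0] = x1[0, 1].
Proof. have := @B0 false 0%N 0%N isT; rewrite /lie_coef /= x10 x20 y10 y20; lra. Qed.

Lemma torsion2 : y2[1, 0] = x2[0, 1].
Proof. have := @B0 true 0%N 0%N isT; rewrite /lie_coef /= x10 x20 y10 y20; lra. Qed.

Let Ex0 m : (m < 4)%N -> Ex m = 0. Proof. by move=> /sx[]. Qed.
Let Dx0 k m : (m < 4)%N -> Dx k m = 0. Proof. by move=> /sx[_ /(_ k)]. Qed.
Let Ey0 m : (m < 4)%N -> Ey m = 0. Proof. by move=> /sy[]. Qed.
Let Dy0 k m : (m < 4)%N -> Dy k m = 0. Proof. by move=> /sy[_ /(_ k)]. Qed.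

Let zeros := (mulr0, addr0, subr0, add0r, oppr0).

(* In each case the right-hand side of [transitivity] exhibits the coefficient as its
   value plus a combination of the symmetry equations and of the vanishing 1-jet. *)
Lemma lie_coef1_20 : B false 2 0 = 2 * liouville1.
Proof.
  transitivity
    (2 * liouville1 + (- 1 / 3) * Dx true 1 + (2 / 3) * Dx false 2 - Dy false 1 + (2)
    * Dy true 0 + (2 * u[3; 0, 0] + y1[0, 1]) * Ex 0 + (x1[0, 1]) * Ex 1 + (- 2 / 3 *
    u[1; 0, 0] - 2 / 3 * x1[1, 0] + 4 / 3 * x2[0, 1]) * Ex 2 + (4 * u[0; 0, 0] - 2 *
    x2[1, 0]) * Ex 3 + (- 2 * u[2; 0, 0] - 3 * x1[0, 1]) * Ey 0 + (4 / 3 * u[1; 0, 0] +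
    1 / 3 * x1[1, 0] - 2 / 3 * x2[0, 1]) * Ey 1 + (- 2 * u[0; 0, 0]) * Ey 2 + (1 / 3 *
    u[1; 0, 0] + 4 / 3 * x1[1, 0] - 2 / 3 * x2[0, 1]) * B false 1 0 + (- 3 * u[0; 0, 0]
    + 2 * x2[1, 0]) * B false 0 1 + (2 * x1[0, 1]) * B true 1 0 + (- 2 / 3 * u[1; 0, 0]
    - 2 / 3 * x1[1, 0] + 4 / 3 * x2[0, 1]) * B true 0 1).
  rewrite /Ex /Ey /Dx /Dy /liouville1 /liouville2 /lie_coef /=.
  by rewrite x10 x20 y10 y20 torsion1 torsion2; lra.
by rewrite ?B0// ?Dx0// ?Dy0// ?Ex0// ?Ey0// !zeros.
Qed.

(** The multipliers of [Dx] and [Dy] are dictated by the third derivatives y1[2, 1] - x1[1, 2] of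
    the left-hand side: [Dx false 3] supplies - x1[1, 2], and the combination of [Dy true 1] and
    [Dy false 2] cancels y2[1, 2] and leaves y1[2, 1]. The other multipliers then clear the second
    derivatives. *)
Lemma lie_coef1_11 : B false 1 1 = liouville2.
Proof.
  transitivity
    (liouville2 + Dx false 3 + (1 / 3) * Dy true 1 + (- 2 / 3) * Dy false 2 +
    (u[3; 0, 0] + y1[0, 1]) * Ex 1 + (- 2 / 3 * u[2; 0, 0] - 1 / 3 * x1[0, 1] + 2 / 3 *
    y2[0, 1]) * Ex 2 + (u[1; 0, 0]) * Ex 3 + (- 2 * u[3; 0, 0] - y1[0, 1]) * Ey 0 + (1 /
    3 * u[2; 0, 0] - 1 / 3 * x1[0, 1] - 1 / 3 * y2[0, 1]) * Ey 1 + (- u[0; 0, 0] -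
    x2[1, 0]) * Ey 3 + (1 / 3 * u[2; 0, 0] + 2 / 3 * x1[0, 1] - 1 / 3 * y2[0, 1]) * B
    false 1 0 + (- u[1; 0, 0] + x2[0, 1]) * B false 0 1 + (y1[0, 1]) * B true 1 0 + (- 2
    / 3 * u[2; 0, 0] - 1 / 3 * x1[0, 1] + 2 / 3 * y2[0, 1]) * B true 0 1).
  rewrite /Ex /Ey /Dx /Dy /liouville1 /liouville2 /lie_coef /=.
  by rewrite x10 x20 y10 y20 torsion1 torsion2; lra.
by rewrite ?B0// ?Dx0// ?Dy0// ?Ex0// ?Ey0// !zeros.
Qed.

Lemma lie_coef1_02 : B false 0 2 = 0.
Proof.
  transitivity
    (Dx true 3 - Dy false 3 + (y1[0, 1]) * Ex 2 + (- x1[0, 1] + 2 * y2[0, 1]) * Ex 3 +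
    (- x1[0, 1]) * Ey 2 + (x1[1, 0] - 2 * x2[0, 1]) * Ey 3 + (- u[2; 0, 0]) * B false 0
    1 + (- 2 * u[3; 0, 0]) * B true 0 1 + (u[3; 0, 0]) * B false 1 0).
  rewrite /Ex /Ey /Dx /Dy /liouville1 /liouville2 /lie_coef /=.
  by rewrite x10 x20 y10 y20 torsion1 torsion2; lra.
by rewrite ?B0// ?Dx0// ?Dy0// ?Ex0// ?Ey0// !zeros.
Qed.

Lemma lie_coef2_20 : B true 2 0 = 0.
Proof.
  transitivity
    (- Dx true 0 + Dy false 0 + (- 2 * x1[0, 1] + y2[0, 1]) * Ex 0 + (- x2[0, 1]) * Ex 1
    + (2 * x1[1, 0] - x2[0, 1]) * Ey 0 + (x2[1, 0]) * Ey 1 + (2 * u[0; 0, 0]) * B false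
    1 0 + (u[1; 0, 0]) * B true 1 0 + (- u[0; 0, 0]) * B true 0 1).
  rewrite /Ex /Ey /Dx /Dy /liouville1 /liouville2 /lie_coef /=.
  by rewrite x10 x20 y10 y20 torsion1 torsion2; lra.
by rewrite ?B0// ?Dx0// ?Dy0// ?Ex0// ?Ey0// !zeros.
Qed.

Lemma lie_coef2_11 : B true 1 1 = liouville1.
Proof.
  transitivity
    (liouville1 + (1 / 3) * Dx false 2 + (- 2 / 3) * Dx true 1 + Dy true 0 +
    (u[3; 0, 0] - y1[0, 1]) * Ex 0 + (- 1 / 3 * u[1; 0, 0] - 1 / 3 * x1[1, 0] - 1 / 3 *
    x2[0, 1]) * Ex 2 + (2 * u[0; 0, 0] - x2[1, 0]) * Ex 3 + (- u[2; 0, 0]) * Ey 0 + (-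
    u[0; 0, 0] + x2[1, 0]) * Ey 2 + (2 / 3 * u[1; 0, 0] + 2 / 3 * x1[1, 0] - 1 / 3 *
    x2[0, 1]) * B false 1 0 + (2 / 3 * u[1; 0, 0] + 2 / 3 * x1[1, 0] - 1 / 3 * x2[0, 1])
    * Ey 1 + (x2[1, 0]) * B false 0 1 + (u[2; 0, 0] + x1[0, 1]) * B true 1 0 + (- 1 / 3
    * u[1; 0, 0] - 1 / 3 * x1[1, 0] + 2 / 3 * x2[0, 1]) * B true 0 1).
  rewrite /Ex /Ey /Dx /Dy /liouville1 /liouville2 /lie_coef /=.
  by rewrite x10 x20 y10 y20 torsion1 torsion2; lra.
by rewrite ?B0// ?Dx0// ?Dy0// ?Ex0// ?Ey0// !zeros.
Qed.

Lemma lie_coef2_02 : B true 0 2 = 2 * liouville2.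
Proof.
  transitivity
    (2 * liouville2 + (2) * Dx false 3 - Dx true 2 + (- 1 / 3) * Dy false 2 + (2 / 3)
    * Dy true 1 + (2 * u[3; 0, 0]) * Ex 1 + (- 4 / 3 * u[2; 0, 0] - 2 / 3 * x1[0, 1] + 1
    / 3 * y2[0, 1]) * Ex 2 + (2 * u[1; 0, 0] - 3 * x2[0, 1]) * Ex 3 + (- 4 * u[3; 0, 0]
    - 2 * y1[0, 1]) * Ey 0 + (- 2 * u[0; 0, 0] + x2[1, 0]) * Ey 3 + (2 / 3 * u[2; 0, 0]
    + 4 / 3 * x1[0, 1] - 2 / 3 * y2[0, 1]) * B false 1 0 + (2 / 3 * u[2; 0, 0] + 4 / 3 *
    x1[0, 1] - 2 / 3 * y2[0, 1]) * Ey 1 + (2 * x2[0, 1]) * B false 0 1 + (x2[0, 1]) * Ey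
    2 + (3 * u[3; 0, 0] + 2 * y1[0, 1]) * B true 1 0 + (- 1 / 3 * u[2; 0, 0] - 2 / 3 *
    x1[0, 1] + 4 / 3 * y2[0, 1]) * B true 0 1).
  rewrite /Ex /Ey /Dx /Dy /liouville1 /liouville2 /lie_coef /=.
  by rewrite x10 x20 y10 y20 torsion1 torsion2; lra.
by rewrite ?B0// ?Dx0// ?Dy0// ?Ex0// ?Ey0// !zeros.
Qed.

End Curvature.

(** * Horizontal subspaces *)

(** The element of g^2 with parameters L_1 and L_2: the factors 2 are those of the relations X^1_11
    = 2 X^2_12 and X^2_22 = 2 X^1_12. *)
Definition liouville_jet (R : realFieldType) (u : nat -> nat -> nat -> R)
    (i : bool) (a b : nat) : R :=
  match i, a, b with
  | false, 2%N, 0%N => 2 * liouville1 u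
  | true, 1%N, 1%N => liouville1 u
  | false, 1%N, 1%N => liouville2 u
  | true, 0%N, 2%N => 2 * liouville2 u
  | _, _, _ => 0
  end.

Section Alternating.
Variables (R : comPzRingType) (U V : lmodType R) (om : U -> U -> V).
Hypotheses (oml : forall w, linear (om ^~ w)).
Hypotheses (oma : forall v w, om w v = - om v w) (oms : forall v, om v v = 0).

Lemma alternating_linear_r v : linear (om v).
Proof.
by move=> c w w'; rewrite -[LHS]opprK -oma oml opprD -scalerN -!oma.
Qed.

(** On a plane an alternating form is the determinant times its value on a basis, so [omega] need
    only be known on the coordinate vectors. *)
Lemma alternating_plane (a b c d : R) (v w : U) :
  om (a *: v + b *: w) (c *: v + d *: w) = (a * d - b * c) *: om v w.
Proof.
have om0 z : om 0 z = 0.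
  by have := oml z (-1) 0 0; rewrite scaler0 addr0 scaleN1r addNr.
have omZ k y z : om (k *: y) z = k *: om y z.
  by have := oml z k y 0; rewrite !addr0 om0 addr0.
have omZr k y z : om y (k *: z) = k *: om y z by rewrite oma omZ -scalerN -oma.
rewrite oml omZ !alternating_linear_r !omZr !oms !scaler0 add0r addr0 (oma v w).
by rewrite !scalerN !scalerA scalerBl.
Qed.

End Alternating.

Definition tbasis (R : realType) (c : bool) : vjet R 0 := [ffun=> cdir R c].

Section Horizontal.
Variables (R : realType) (theta : Jpi R 2) (H : {vspace vjet R 3}).
Hypotheses (hH : horizontal theta H) (H0 : bracket_1jet_zero theta.1 H).

Lemma hliftP v : hlift H v \in H /\ jproj (leq0n 3) (hlift H v) = v.
Proof.
have [_ _ /(_ v)[xi [Hxi _]]] := hH.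
exact: (@xgetPex _ 0 [set xi | xi \in H /\ jproj (leq0n 3) xi = v] (ex_intro _ xi Hxi)).
Qed.

(** The right-hand side lies in H and projects to c v + w; the lift with these properties is
    unique. *)
Lemma hlift_linear c v w : hlift H (c *: v + w) = c *: hlift H v + hlift H w.
Proof.
have [_ _ /(_ (c *: v + w))[xi [_ xi_uniq]]] := hH.
rewrite -[LHS](xi_uniq _ (hliftP _)); apply: xi_uniq.
have [Hv pv] := hliftP v; have [Hw pw] := hliftP w.
split; first by rewrite memvD ?memvZ.
by rewrite -{2}pv -{2}pw; apply/ffunP => al; rewrite !ffunE.
Qed.

Lemma jx_hlift v i : jx (hlift H v) i 0%N 0%N = jx v i 0%N 0%N.
Proof. by rewrite -[in RHS](hliftP v).2 [RHS]/jx jproj_coef. Qed.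

Lemma hlift_sym_jet v :
  sym_jet (jx (hlift H v)) (fun m a b => jcoef theta.2 a b 0 (inord m)).
Proof. by apply: Aspace_sym_jet; have [+ _ _] := hH; apply; have [] := hliftP v. Qed.

Let jx_e c i : jx (tbasis R c) i 0%N 0%N = (c == i)%:R.
Proof.
rewrite /jx (@jcoefE 0 _ (tbasis R c) 0 0 isT) ffunE mxE eqxx /=.
by case: c; case: i.
Qed.

(** The crux: the right-hand side depends on theta but not on H. *)
Lemma omega_basis i a b : (a + b <= 2)%N ->
  jx (omega theta.1 H (tbasis R false) (tbasis R true)) i a b =
  liouville_jet (fun m a b => jcoef theta.2 a b 0 (inord m)) i a b.
Proof.
set u := (X in liouville_jet X); move=> ab; rewrite jlie_coef//.
set x := jx (hlift H (tbasis R false)); set y := jx (hlift H (tbasis R true)).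
have sx : sym_jet x u by exact: hlift_sym_jet.
have sy : sym_jet y u by exact: hlift_sym_jet.
have x10 : x false 0%N 0%N = 1 by rewrite [LHS]jx_hlift jx_e.
have x20 : x true 0%N 0%N = 0 by rewrite [LHS]jx_hlift jx_e.
have y10 : y false 0%N 0%N = 0 by rewrite [LHS]jx_hlift jx_e.
have y20 : y true 0%N 0%N = 1 by rewrite [LHS]jx_hlift jx_e.
have B0 j c d : (c + d <= 1)%N -> lie_coef x y j c d = 0.
  move=> cd; rewrite -(@jlie_coef R 2 theta.1); last exact: leq_trans cd _.
  rewrite /jx -(jproj_coef (leqnSn 1) _ cd) H0; try by have [] := hliftP.
    exact: jx0.
  by have [] := hliftP (tbasis R false).
  by have [] := hliftP (tbasis R true).
move: a b i ab => [|[|[|a]]] [|[|[|b]]] [] // _;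
  rewrite ?(B0 _ 0%N 0%N isT) ?(B0 _ 0%N 1%N isT) ?(B0 _ 1%N 0%N isT) //.
- exact: lie_coef2_02 sx sy x10 x20 y10 y20 B0.
- exact: lie_coef1_02 sx sy x10 x20 y10 y20 B0.
- exact: lie_coef2_11 sx sy x10 x20 y10 y20 B0.
- exact: lie_coef1_11 sx sy x10 x20 y10 y20 B0.
- exact: lie_coef2_20 sx sy x10 x20 y10 y20 B0.
- exact: lie_coef1_20 sx sy x10 x20 y10 y20 B0.
Qed.

Let vE (v : vjet R 0) :
  v = jx v false 0%N 0%N *: tbasis R false + jx v true 0%N 0%N *: tbasis R true.
Proof.
apply: vjet_ext => -[|//] [|//] i _.
rewrite jx_comb -[jx v true _ _ *: tbasis R true]addr0 jx_comb jx0 !jx_e.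
by case: i; rewrite /= ?mulr1 ?mulr0 ?addr0 ?add0r.
Qed.

Lemma omega_linear_l w : linear (omega theta.1 H ^~ w).
Proof. by move=> c v v'; rewrite /omega hlift_linear jlie_linear. Qed.

Lemma omega_anti v w : omega theta.1 H w v = - omega theta.1 H v w.
Proof. exact: jlie_anti. Qed.

Lemma omega_self v : omega theta.1 H v v = 0.
Proof. exact: jlie_self. Qed.

Lemma omegaE v w :
  omega theta.1 H v w =
  (jx v false 0%N 0%N * jx w true 0%N 0%N - jx v true 0%N 0%N * jx w false 0%N 0%N)
    *: omega theta.1 H (tbasis R false) (tbasis R true).
Proof.
move: omega_linear_l omega_anti omega_self; move: (omega theta.1 H) => om oml oma oms.
by rewrite {1}(vE v) {1}(vE w) (alternating_plane oml oma oms).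
Qed.

Lemma omega_g2 v w : g2space (omega theta.1 H v w).
Proof.
have jom i a b : (a + b <= 2)%N -> jx (omega theta.1 H v w) i a b =
    (jx v false 0%N 0%N * jx w true 0%N 0%N - jx v true 0%N 0%N * jx w false 0%N 0%N)
    * liouville_jet (fun m a b => jcoef theta.2 a b 0 (inord m)) i a b.
  by move=> ab; rewrite -omega_basis// -[in LHS](addr0 (omega _ _ _ _)) omegaE jx_comb jx0 addr0.
move: jom; set om := omega _ _ _ _; set c := (_ - _); set l := liouville_jet _ => jom.
split.
  apply: vjet_ext => a b i ab; rewrite /jx jproj_coef// -/(jx _ _ _ _) jom; last exact: leq_trans ab _.
  have -> : l i a b = 0 by move: a b i ab => [|[|a]] [|[|b]] [].
  by rewrite mulr0; exact: (esym (jx0 R 1 i a b)).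
have E20 i : om (@mi2 2 0 isT) 0 (ob i) = c * l i 2%N 0%N.
  by rewrite -jom// /jx (@jcoefE 2 _ om 2 0 isT).
have E11 i : om (@mi2 1 1 isT) 0 (ob i) = c * l i 1%N 1%N.
  by rewrite -jom// /jx (@jcoefE 2 _ om 1 1 isT).
have E02 i : om (@mi2 0 2 isT) 0 (ob i) = c * l i 0%N 2%N.
  by rewrite -jom// /jx (@jcoefE 2 _ om 0 2 isT).
split=> /=.
- by rewrite (E20 true) mulr0.
- by rewrite (E20 false) (E11 true) /l /=; ring.
- by rewrite (E11 false) (E02 true) /l /=; ring.
- by rewrite (E02 false) mulr0.
Qed.

End Horizontal.

Theorem theorem5p3 (R : realType) (theta : Jpi R 2) :
  (forall H : {vspace vjet R 3},
     horizontal theta H -> bracket_1jet_zero theta.1 H ->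
     two_form (@g2space R) (omega theta.1 H)) /\
  (forall H H' : {vspace vjet R 3},
     horizontal theta H -> bracket_1jet_zero theta.1 H ->
     horizontal theta H' -> bracket_1jet_zero theta.1 H' ->
     omega theta.1 H = omega theta.1 H').
Proof.
split=> [H hH H0|H H' hH H0 hH' H0'].
  split=> [w c v v'|v|v|v w].
  - exact: omega_linear_l hH w c v v'.
  - exact: (alternating_linear_r (omega_linear_l hH) (@omega_anti R theta H)).
  - exact: omega_self.
  - exact: omega_g2.
(* Both values have the coefficients [liouville_jet] of theta. *)
have E : omega theta.1 H (tbasis R false) (tbasis R true) =
    omega theta.1 H' (tbasis R false) (tbasis R true).
  apply: vjet_ext => a b i ab.
  exact: (etrans (omega_basis hH H0 i ab) (esym (omega_basis hH' H0' i ab))).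
apply/funext => v; apply/funext => w.
apply: (etrans (omegaE hH v w)); apply: (etrans _ (esym (omegaE hH' v w))).
exact: (congr1 (GRing.scale _) E).
Qed.
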